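(* Let $F$ be a finite extension of $\mathbf{Q}_p$ with uniformizer $\pi$. Then $\operatorname{Pol}(o_F [\![X]\!]^{\psi=0}) + \pi \cdot \operatorname{Int} = \operatorname{Int}$.
   Context: $o_F$ is the ring of integers of $F$, $\pi$ a uniformizer, $q$ the cardinality of the residue field. $\operatorname{LT}$ is the Lubin–Tate formal group over $o_F$ attached to $\pi$, with a chosen coordinate $X$; $[a](X)\in o_F[\![X]\!]$ is the endomorphism attached to $a\in o_F$ and $T\oplus U$ the formal addition law. $\operatorname{Int}=\{P\in F[T]: P(o_F)\subset o_F\}$. For $f\in o_F[\![X]\!]$ there are polynomials $c_{f,n}\in\operatorname{Int}$ with $f([a](X))=\sum_{n\ge0}c_{f,n}(a)X^n$ for all $a\in o_F$. For $M\subset o_F[\![X]\!]$, $\operatorname{Pol}(M)$ is the $o_F$-submodule of $\operatorname{Int}$ generated by the $c_{f,n}$ with $f\in M$, $n\ge0$. $\phi(f)(X)=f([\pi](X))$, and $\psi:o_F[\![X]\!]\to o_F[\![X]\!]$ is defined by $\phi(\psi(f))=\frac1\pi\operatorname{Tr}_{o_F[\![X]\!]/\phi(o_F[\![X]\!])}(f)$ (equivalently $\psi(f)=0$ iff $\sum_{[\pi](\eta)=0}f(X\oplus\eta)=0$, the sum over $\eta$ in the maximal ideal of $o_{\mathbf{C}_p}$). $o_F[\![X]\!]^{\psi=0}$ is the kernel of $\psi$. *)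

(* Defs.v *)
From HB Require Import structures.
From mathcomp Require Import all_boot all_order all_algebra all_field.
From mathcomp Require Import boolp classical_sets functions cardinality.
From mathcomp Require Import mpoly.

Set Implicit Arguments.
Unset Strict Implicit.
Unset Printing Implicit Defensive.

Import GRing.Theory.
Local Open Scope classical_set_scope.
Local Open Scope ring_scope.

(* The ring Z_p as the inverse limit of the rings Z/p^(n+1), n >= 0, and      *)
(* Q_p as its field of fractions.                                             *)

Definition Zp_coherent (p : nat) (x : forall n, 'Z_(p ^ n.+1)) : Prop :=
  forall n, x n = (x n.+1 : nat)%:R.

Record padic_int (p : nat) (p_prime : prime p) := PadicInt {
  residue_at : forall n, 'Z_(p ^ n.+1);
  residue_atP : Zp_coherent residue_at
}.

Section PadicIntegers.
Context (p : nat) (p_prime : prime p).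
Local Notation Zp := (padic_int p_prime).
Implicit Types (x y z : Zp) (n : nat).

Lemma padic_intP x y : (forall n, residue_at x n = residue_at y n) <-> x = y.
Proof.
split=> [|-> //]; case: x y => [x Px] [y Py] /= exy.
have {}exy : x = y by apply: functional_extensionality_dep.
by case: _ / exy Py => Py; congr PadicInt; apply: Prop_irrelevance.
Qed.

Lemma expp_gt1 n : (1 < p ^ n.+1)%N.
Proof. by rewrite -(exp1n n.+1) ltn_exp2r // prime_gt1. Qed.

Lemma natr_Zp_mod n k :
  (k %% p ^ n.+2)%:R = k%:R :> 'Z_(p ^ n.+1).
Proof.
rewrite -[LHS]Zp_nat_mod ?expp_gt1 // modn_dvdm ?Zp_nat_mod ?expp_gt1 //.
exact: dvdn_exp2l.
Qed.

Definition Zp_reduce n (a : 'Z_(p ^ n.+2)) : 'Z_(p ^ n.+1) := (a : nat)%:R.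

Lemma Zp_reduce_nat n k : Zp_reduce (k%:R : 'Z_(p ^ n.+2)) = k%:R.
Proof. by rewrite /Zp_reduce val_Zp_nat ?expp_gt1 // natr_Zp_mod. Qed.

Lemma Zp_reduceD n : {morph @Zp_reduce n : a b / a + b}.
Proof.
move=> a b; rewrite -{1}(natr_Zp a) -{1}(natr_Zp b) -natrD Zp_reduce_nat.
by rewrite natrD.
Qed.

Lemma Zp_reduceM n : {morph @Zp_reduce n : a b / a * b}.
Proof.
move=> a b; rewrite -{1}(natr_Zp a) -{1}(natr_Zp b) -natrM Zp_reduce_nat.
by rewrite natrM.
Qed.

Lemma Zp_reduceN n : {morph @Zp_reduce n : a / - a}.
Proof.
move=> a; apply/eqP; rewrite -addr_eq0 -Zp_reduceD addNr.
by rewrite -(mulr0n 1) Zp_reduce_nat.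
Qed.

Fact Zp_coherent0 : Zp_coherent (fun n => 0 : 'Z_(p ^ n.+1)).
Proof. by []. Qed.
Fact Zp_coherent1 : Zp_coherent (fun n => 1 : 'Z_(p ^ n.+1)).
Proof. by move=> n; rewrite -[RHS](Zp_reduce_nat n 1). Qed.
Fact Zp_coherentN x : Zp_coherent (fun n => - residue_at x n).
Proof. by move=> n; rewrite [RHS]Zp_reduceN {1}(residue_atP x). Qed.
Fact Zp_coherentD x y : Zp_coherent (fun n => residue_at x n + residue_at y n).
Proof.
by move=> n; rewrite [RHS]Zp_reduceD {1}(residue_atP x) {1}(residue_atP y).
Qed.
Fact Zp_coherentM x y : Zp_coherent (fun n => residue_at x n * residue_at y n).
Proof.
by move=> n; rewrite [RHS]Zp_reduceM {1}(residue_atP x) {1}(residue_atP y).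
Qed.

HB.instance Definition _ := gen_eqMixin Zp.
HB.instance Definition _ := gen_choiceMixin Zp.

Definition padic_zero : Zp := PadicInt p_prime Zp_coherent0.
Definition padic_one : Zp := PadicInt p_prime Zp_coherent1.
Definition padic_opp x : Zp := PadicInt p_prime (Zp_coherentN x).
Definition padic_add x y : Zp := PadicInt p_prime (Zp_coherentD x y).
Definition padic_mul x y : Zp := PadicInt p_prime (Zp_coherentM x y).

Fact padic_addA : associative padic_add.
Proof. by move=> x y z; apply/padic_intP => n; apply: addrA. Qed.
Fact padic_addC : commutative padic_add.
Proof. by move=> x y; apply/padic_intP => n; apply: addrC. Qed.
Fact padic_add0 : left_id padic_zero padic_add.
Proof. by move=> x; apply/padic_intP => n; apply: add0r. Qed.
Fact padic_addN : left_inverse padic_zero padic_opp padic_add.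
Proof. by move=> x; apply/padic_intP => n; apply: addNr. Qed.

HB.instance Definition _ :=
  GRing.isZmodule.Build Zp padic_addA padic_addC padic_add0 padic_addN.

Fact padic_mulA : associative padic_mul.
Proof. by move=> x y z; apply/padic_intP => n; apply: mulrA. Qed.
Fact padic_mulC : commutative padic_mul.
Proof. by move=> x y; apply/padic_intP => n; apply: mulrC. Qed.
Fact padic_mul1 : left_id padic_one padic_mul.
Proof. by move=> x; apply/padic_intP => n; apply: mul1r. Qed.
Fact padic_mulD : left_distributive padic_mul padic_add.
Proof. by move=> x y z; apply/padic_intP => n; apply: mulrDl. Qed.
Fact padic_one_neq0 : padic_one != padic_zero.
Proof. by apply/eqP => /padic_intP/(_ 0)/eqP; rewrite oner_eq0. Qed.

HB.instance Definition _ := GRing.Zmodule_isComNzRing.Build Zp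
  padic_mulA padic_mulC padic_mul1 padic_mulD padic_one_neq0.

Definition padic_unit : {pred Zp} := fun x => `[< exists y, y * x = 1 >].
Definition padic_inv x : Zp :=
  if x \in padic_unit then xget x [set y | y * x = 1] else x.

Fact padic_mulV : {in padic_unit, left_inverse 1 padic_inv *%R}.
Proof.
move=> x ux; rewrite /padic_inv ux.
by case: xgetP => // noy; have /asboolP[y /noy] := ux.
Qed.
Fact padic_unitP x y : y * x = 1 -> x \in padic_unit.
Proof. by move=> xy1; apply/asboolP; exists y. Qed.
Fact padic_inv_out : {in [predC padic_unit], padic_inv =1 id}.
Proof. by move=> x /negbTE ux; rewrite /padic_inv [x \in _]ux. Qed.

HB.instance Definition _ :=
  GRing.ComNzRing_hasMulInverse.Build Zp padic_mulV padic_unitP padic_inv_out.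

Lemma residue_at_leq x m n :
  (m <= n)%N -> residue_at x n = 0 -> residue_at x m = 0.
Proof.
elim: n => [|n IHn]; first by rewrite leqn0 => /eqP ->.
rewrite leq_eqVlt => /predU1P[-> //|le_mn xn0].
by apply: IHn => //; rewrite residue_atP xn0.
Qed.

Lemma residue_at_eq0 x m n : (m <= n)%N ->
  (residue_at x m == 0) = (p ^ m.+1 %| (residue_at x n : nat))%N.
Proof.
move=> le_mn; suff -> : residue_at x m = (residue_at x n : nat)%:R.
  by rewrite -val_eqE /= val_Zp_nat ?expp_gt1.
elim: n le_mn => [|n IHn].
  by rewrite leqn0 => /eqP ->; rewrite natr_Zp.
rewrite leq_eqVlt => /predU1P[->|le_mn]; first by rewrite natr_Zp.
rewrite IHn // [in LHS]residue_atP val_Zp_nat ?expp_gt1 //.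
rewrite -[LHS]Zp_nat_mod ?expp_gt1 // modn_dvdm ?Zp_nat_mod ?expp_gt1 //.
exact: dvdn_exp2l.
Qed.

Fact padic_idomain : GRing.integral_domain_axiom Zp.
Proof.
move=> x y xy0; apply/norP => -[/eqP nx0 /eqP ny0].
have nz z : z <> 0 -> exists n, residue_at z n != 0.
  move=> z0; apply: contrapT => /forallNP z0'; apply: z0; apply/padic_intP => n.
  by apply/eqP/negP => /negP/z0'.
have [[m xm] [n yn]] := (nz x nx0, nz y ny0).
have mN : (m <= (m + n).+1)%N by rewrite -addnS leq_addr.
have nN : (n <= (m + n).+1)%N by rewrite -addSn leq_addl.
have xyN : residue_at (x * y) (m + n).+1 == 0 by rewrite xy0.
rewrite (residue_at_eq0 _ (leqnn _)) in xyN.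
rewrite (residue_at_eq0 _ mN) in xm; rewrite (residue_at_eq0 _ nN) in yn.
set a := residue_at x _ in xm *; set b := residue_at y _ in yn *.
have ab0 : (p ^ (m + n).+2 %| (a : nat) * (b : nat))%N.
  suff abE : residue_at (x * y) (m + n).+1 = ((a : nat) * (b : nat))%N%:R.
    by rewrite abE val_Zp_nat ?expp_gt1 // /dvdn modn_mod in xyN.
  by rewrite natrM !natr_Zp.
move: xm yn ab0; move: (nat_of_ord a) (nat_of_ord b) => {}a {}b xm yn.
have [a0|a_gt0] := posnP a; first by rewrite a0 dvdn0 in xm.
have [b0|b_gt0] := posnP b; first by rewrite b0 dvdn0 in yn.
move: xm yn; rewrite !pfactor_dvdn ?muln_gt0 ?a_gt0 // lognM // -!ltnNge !ltnS.
by move=> xm yn /ltnW; rewrite ltnNge leq_add.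
Qed.

HB.instance Definition _ :=
  GRing.ComUnitRing_isIntegral.Build Zp padic_idomain.

Definition padic_field : fieldType := {fraction Zp}.

End PadicIntegers.

Notation "'Z_[ pr ]" := (padic_int pr) (at level 0, format "''Z_[' pr ]").
Notation "'Q_[ pr ]" := (padic_field pr) (at level 0, format "''Q_[' pr ]").

Section RingOfIntegers.
Context (p : nat) (p_prime : prime p) (F : fieldExtType 'Q_[p_prime]).

Definition Zp_embed (z : 'Z_[p_prime]) : F := (FracField.tofrac z)%:A.

Fact Zp_embed_zmod : zmod_morphism Zp_embed.
Proof. by move=> x y; rewrite /Zp_embed rmorphB scalerBl. Qed.
Fact Zp_embed_monoid : monoid_morphism Zp_embed.
Proof.
split=> [|x y]; rewrite /Zp_embed; first by rewrite rmorph1 scale1r.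
by rewrite rmorphM -[LHS]/(in_alg F _) rmorphM.
Qed.
HB.instance Definition _ :=
  GRing.isZmodMorphism.Build 'Z_[p_prime] F Zp_embed Zp_embed_zmod.
HB.instance Definition _ :=
  GRing.isMonoidMorphism.Build 'Z_[p_prime] F Zp_embed Zp_embed_monoid.

(* The integral closure of Z_p in F. *)
Definition integer : {pred F} := fun x => `[< integralOver Zp_embed x >].

Fact integer_subring : subring_closed integer.
Proof.
by split=> [|x y /asboolP xi /asboolP yi|x y /asboolP xi /asboolP yi];
  apply/asboolP; [exact: integral1|exact: integral_sub|exact: integral_mul].
Qed.
HB.instance Definition _ :=
  GRing.isSubringClosed.Build F integer integer_subring.

Record ring_of_integers := RingOfIntegers {
  integer_val :> F;
  _ : integer_val \in integer
}.

HB.instance Definition _ := [isSub for integer_val].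
HB.instance Definition _ := [Choice of ring_of_integers by <:].
HB.instance Definition _ :=
  [SubChoice_isSubComNzRing of ring_of_integers by <:].

End RingOfIntegers.

Notation "''o_[' F ]" := (ring_of_integers F) (at level 0, format "''o_[' F ]").

(* A uniformizer is a generator of the maximal ideal, the set of non-units.   *)
Definition uniformizer (R : comNzRingType) (pi : R) : Prop :=
  [set x : R | ~ exists y, x * y = 1] = range ( *%R pi).

Definition coset (R : comNzRingType) (pi x : R) : set R :=
  [set y | exists z, y = x + pi * z].

Definition residue_card (R : comNzRingType) (pi : R) (q : nat) : Prop :=
  (range (coset pi) #= `I_q)%card.

(* R[[X]]: [f n] is the coefficient of X^n. *)
Record fps (R : Type) := Fps { coefs :> nat -> R }.

Notation "{ 'fps' R }" := (fps R) (format "{ 'fps'  R }").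

Section PowerSeries.
Context (R : comNzRingType).
Implicit Types (f g h : {fps R}) (n : nat) (a : R).

Lemma fpsP f g : f =1 g <-> f = g.
Proof.
split=> [|-> //]; case: f g => [f] [g] /= fg.
by congr Fps; apply: functional_extensionality_dep.
Qed.

HB.instance Definition _ := gen_eqMixin {fps R}.
HB.instance Definition _ := gen_choiceMixin {fps R}.

Definition fps_const a : {fps R} := Fps (fun n => if n == 0%N then a else 0).
Definition fps_opp f : {fps R} := Fps (fun n => - f n).
Definition fps_add f g : {fps R} := Fps (fun n => f n + g n).
Definition fps_mul f g : {fps R} :=
  Fps (fun n => \sum_(i < n.+1) f i * g (n - i)%N).
Definition fps_scale a f : {fps R} := Fps (fun n => a * f n).

Fact fps_addA : associative fps_add.
Proof. by move=> f g h; apply/fpsP => n; apply: addrA. Qed.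
Fact fps_addC : commutative fps_add.
Proof. by move=> f g; apply/fpsP => n; apply: addrC. Qed.
Fact fps_add0 : left_id (fps_const 0) fps_add.
Proof. by move=> f; apply/fpsP => n /=; rewrite if_same add0r. Qed.
Fact fps_addN : left_inverse (fps_const 0) fps_opp fps_add.
Proof. by move=> f; apply/fpsP => n /=; rewrite if_same addNr. Qed.

HB.instance Definition _ :=
  GRing.isZmodule.Build {fps R} fps_addA fps_addC fps_add0 fps_addN.

Fact fps_mulC : commutative fps_mul.
Proof.
move=> f g; apply/fpsP => n /=; rewrite (reindex_inj rev_ord_inj) /=.
by apply: eq_bigr => i _; rewrite (sub_ordK i) mulrC.
Qed.

Fact fps_mul_rev f g n :
  fps_mul f g n = \sum_(i < n.+1) f (n - i)%N * g i.
Proof. by rewrite fps_mulC; apply: eq_bigr => i _; rewrite mulrC. Qed.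

Fact fps_mulE f g n : fps_mul f g n = \sum_(i < n.+1) f i * g (n - i)%N.
Proof. by []. Qed.

Fact fps_mulA : associative fps_mul.
Proof.
move=> f g h; apply/fpsP => n; rewrite fps_mulE fps_mul_rev.
pose coef3 j k := f j * (g (n - j - k)%N * h k).
transitivity (\sum_(j < n.+1) \sum_(k < n.+1 | (k <= n - j)%N) coef3 j k).
  apply: eq_bigr => j _; rewrite fps_mul_rev big_distrr /=.
  by rewrite (big_ord_narrow_leq (leq_subr _ _)).
rewrite (exchange_big_dep predT) //=; apply: eq_bigr => k _.
transitivity (\sum_(j < n.+1 | (j <= n - k)%N) coef3 j k).
  apply: eq_bigl => j; rewrite -ltnS -(ltnS j) -!subSn ?leq_ord //.
  by rewrite -subn_gt0 -(subn_gt0 j) -!subnDA addnC.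
rewrite (big_ord_narrow_leq (leq_subr _ _)) big_distrl /=.
by apply: eq_bigr => j _; rewrite /coef3 -!subnDA addnC mulrA.
Qed.

Fact fps_mul1 : left_id (fps_const 1) fps_mul.
Proof.
move=> f; apply/fpsP => n /=; rewrite big_ord_recl subn0 mul1r.
by rewrite big1 ?addr0 // => i _; rewrite mul0r.
Qed.
Fact fps_mulD : left_distributive fps_mul +%R.
Proof.
move=> f g h; apply/fpsP => n /=; rewrite -big_split /=.
by apply: eq_bigr => i _; rewrite mulrDl.
Qed.
Fact fps_one_neq0 : fps_const 1 != 0 :> {fps R}.
Proof. by apply/eqP => /fpsP/(_ 0)/eqP; rewrite oner_eq0. Qed.

HB.instance Definition _ := GRing.Zmodule_isComNzRing.Build {fps R}
  fps_mulA fps_mulC fps_mul1 fps_mulD fps_one_neq0.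

Fact fps_scaleA a b f : fps_scale a (fps_scale b f) = fps_scale (a * b) f.
Proof. by apply/fpsP => n; apply: mulrA. Qed.
Fact fps_scale1 : left_id 1 fps_scale.
Proof. by move=> f; apply/fpsP => n; apply: mul1r. Qed.
Fact fps_scaleDr : right_distributive fps_scale +%R.
Proof. by move=> a f g; apply/fpsP => n; apply: mulrDr. Qed.
Fact fps_scaleDl f : {morph fps_scale^~ f : a b / a + b}.
Proof. by move=> a b; apply/fpsP => n; apply: mulrDl. Qed.

HB.instance Definition _ := GRing.Zmodule_isLmodule.Build R {fps R}
  fps_scaleA fps_scale1 fps_scaleDr fps_scaleDl.

Fact fps_scaleAl a f g : a *: (f * g) = (a *: f) * g.
Proof.
apply/fpsP => n /=; rewrite big_distrr /=.
by apply: eq_bigr => i _; rewrite mulrA.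
Qed.
HB.instance Definition _ :=
  GRing.Lmodule_isLalgebra.Build R {fps R} fps_scaleAl.
HB.instance Definition _ := GRing.Lalgebra_isComAlgebra.Build R {fps R}.

Definition fpsX : {fps R} := Fps (fun n => (n == 1%N)%:R).

(* f(g(X)) = \sum_k f_k g(X)^k, for g without constant term: the terms with   *)
(* k > n do not contribute to the coefficient of X^n.                         *)
Definition fps_comp f g : {fps R} :=
  Fps (fun n => \sum_(k < n.+1) f k * (g ^+ k) n).

End PowerSeries.

(* Power series in n variables, and the substitution f(g_1, ..., g_n) of      *)
(* series g_i without constant term: its coefficients of total degree d only  *)
(* depend on the truncations of f and of the g_i to total degree d.           *)
Definition mfps (n : nat) (R : Type) := 'X_{1..n} -> R.

Section MultivariatePowerSeries.
Context (R : comNzRingType).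

Definition mfps_trunc n (d : nat) (f : mfps n R) : {mpoly R[n]} :=
  \sum_(m : 'X_{1..n < d.+1}) f m *: 'X_[m].

Definition mfps_subst n k (f : mfps n R) (g : n.-tuple (mfps k R)) : mfps k R :=
  fun m => let d := mdeg m in
    (mfps_trunc d f \mPo [tuple mfps_trunc d (tnth g i) | i < n])@_m.

Definition mfps_var n (i : 'I_n) : mfps n R := fun m => (m == U_(i)%MM)%:R.

Definition mfps_of_fps (f : {fps R}) : mfps 1 R := fun m => f (m ord0).

Record formal_group_law (G : mfps 2 R) : Prop := FormalGroupLaw {
  fgl_const : G 0%MM = 0;
  fgl_linear : forall i, G U_(i)%MM = 1;
  fgl_assoc : let X := @mfps_var 3 (inord 0) in let Y := mfps_var (inord 1) in
    let Z := mfps_var (inord 2) in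
    mfps_subst G [tuple mfps_subst G [tuple X; Y]; Z] =
    mfps_subst G [tuple X; mfps_subst G [tuple Y; Z]];
  fgl_comm : mfps_subst G [tuple mfps_var (inord 1); mfps_var (inord 0)] = G
}.

(* A formal R-module: a ring morphism a |-> [a] from R to the endomorphisms   *)
(* of the formal group law G such that [a](X) = a X + ...                     *)
Record formal_module (G : mfps 2 R) (act : R -> {fps R}) : Prop :=
  FormalModule {
    fm_group : formal_group_law G;
    fm_const : forall a, act a 0%N = 0;
    fm_linear : forall a, act a 1%N = a;
    fm_endo : forall a, let f := mfps_of_fps (act a) in
      mfps_subst f [tuple G] =
      mfps_subst G [tuple mfps_subst f [tuple mfps_var i] | i < 2];
    fm_one : act 1 = fpsX R;
    fm_add : forall a b,
      mfps_subst G [tuple mfps_of_fps (act a); mfps_of_fps (act b)] =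
      mfps_of_fps (act (a + b));
    fm_mul : forall a b, fps_comp (act a) (act b) = act (a * b)
  }.

(* [pi](X) = pi X + ... and [pi](X) = X^q modulo pi; this does not depend on  *)
(* the coordinate when R / (pi) is a field with q elements.                   *)
Record lubin_tate (pi : R) (q : nat) := LubinTate {
  lt_law : mfps 2 R;
  lt_act : R -> {fps R};
  lt_module : formal_module lt_law lt_act;
  lt_frobenius : forall n, exists c, lt_act pi n = (n == q)%:R + pi * c
}.

End MultivariatePowerSeries.

(* The trace of B over a subring A over which B is free of finite rank: the   *)
(* trace of the matrix of multiplication by b in an A-basis of B. It does not *)
(* depend on the basis, so that [xget] has at most one value to choose.       *)

Definition free_basis (B : comNzRingType) (A : set B) n (e : 'I_n -> B) : Prop :=
  forall b, exists! c : {ffun 'I_n -> B},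
    (forall i, A (c i)) /\ b = \sum_i c i * e i.

Definition is_trace (B : comNzRingType) (A : set B) (b t : B) : Prop :=
  exists n (e : 'I_n -> B) (M : 'M[B]_n),
    [/\ free_basis A e, forall i j, A (M i j),
        forall j, b * e j = \sum_i M i j * e i & t = \tr M].

Definition trace (B : comNzRingType) (A : set B) (b : B) : B :=
  xget 0 (is_trace A b).

Section Psi.
Context (R : comNzRingType) (pi : R) (q : nat) (LT : lubin_tate pi q).

Definition lt_phi (f : {fps R}) : {fps R} := fps_comp f (lt_act LT pi).

(* phi (psi f) = pi^-1 Tr f: the trace takes values in pi phi(R[[X]]), and    *)
(* pi phi is injective, when R is the ring of integers of a p-adic field.     *)
Definition lt_psi (f : {fps R}) : {fps R} :=
  xget 0 [set g | pi *: lt_phi g = trace (range lt_phi) f].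

Definition psi_kernel : set {fps R} := [set f | lt_psi f = 0].

End Psi.

Section IntegerValuedPolynomials.
Context (p : nat) (p_prime : prime p) (F : fieldExtType 'Q_[p_prime]).

Definition Int : set {poly F} :=
  [set P | forall a : 'o_[F], P.[a : F] \in @integer p p_prime F].

Definition oF_span (C : set {poly F}) : set {poly F} :=
  [set P | exists n (l : 'I_n -> 'o_[F]) (c : 'I_n -> {poly F}),
     (forall i, C (c i)) /\ P = \sum_i (l i : F) *: c i].

Context (pi : 'o_[F]) (q : nat) (LT : lubin_tate pi q).

(* [c] is the polynomial c_{f,n}; it is unique since o_F is infinite. *)
Definition is_lt_coef (f : {fps 'o_[F]}) (n : nat) (c : {poly F}) : Prop :=
  forall a : 'o_[F], c.[a : F] = integer_val (fps_comp f (lt_act LT a) n).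

Definition Pol (M : set {fps 'o_[F]}) : set {poly F} :=
  oF_span [set c | exists f n, [/\ M f, Int c & is_lt_coef f n c]].

End IntegerValuedPolynomials.

Arguments Int {p p_prime} F.

(* Main.v *)
(* Modulo pi, an integer-valued polynomial is a locally constant function on
   o_F, so it suffices to produce all such functions from the c_{f,n} with
   psi(f) = 0.  Since [pi^M](X) = X^(q^M) modulo pi, the c_{f phi^M(g), n} are
   modulo pi the sums over i of c_{f, n - q^M i} c_{g, i}; by induction on i,
   the span of the c_{f,n}, f in a phi(o_F[[X]])-module K, contains all products
   c_{f,j} c_{g,i} with f in K and g arbitrary.  Taking K = o_F[[X]], the span
   is an algebra, and it is the algebra of all locally constant functions since
   the coefficients of X^(q^m) in [a](X) play the role of the digits of a.
   Taking K = ker psi, the span is an ideal of that algebra, and it contains a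
   unit as soon as some h in ker psi has h(0) a unit.  Such an h is obtained
   from f0 = [pi](X) / X, whose trace over phi(o_F[[X]]) is phi(n) with
   n(0) = pi: take h = phi(n / pi) - (q / pi) f0. *)

From HB Require Import structures.
Require Import Defs.
From mathcomp Require Import all_boot all_order all_algebra all_field.
From mathcomp Require Import boolp classical_sets functions cardinality.
From mathcomp Require Import mpoly ring.

Set Implicit Arguments.
Unset Strict Implicit.
Unset Printing Implicit Defensive.

Import GRing.Theory.
Local Open Scope classical_set_scope.
Local Open Scope ring_scope.

(** * Composition of power series *)

(** The kernel of psi is not closed under products: it is only a module over the image of phi, so
    products f phi^M(g) are all that is available. They suffice because q^M may exceed j: in degree
    j + q^M i, the product c_{f,j} c_{g,i} is then the only term whose g-index reaches i. Digits
    come from the formal sum of [a] and [c]([pi^L]), which is [a + pi^L c]: modulo pi the second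
    summand begins with c X^(q^L), so the coefficient of X^(q^L) moves by c. Differences of distinct
    residues being units, interpolation in these digits is possible. The correction (q / pi) f0
    makes traces cancel, since phi(n / pi) has trace q phi(n / pi); the constant term of h is 1 - q,
    a unit because pi divides q. All this is done over an abstract complete local ring with
    uniformizer pi and q residues; that o_F is one is proved separately, from integral equations
    over Z_p. *)

Section FpsComp.
Context (R : comNzRingType).
Implicit Types (f g h : {fps R}) (p : {poly R}).

Lemma coef_fps_sum I (r : seq I) (P : pred I) (F : I -> {fps R}) n :
  (\sum_(i <- r | P i) F i) n = \sum_(i <- r | P i) F i n.
Proof.
by apply: (big_morph (fun f : {fps R} => f n)) => //=; rewrite if_same.
Qed.

Lemma coef_fpsD f g n : (f + g) n = f n + g n.
Proof. by []. Qed.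

Lemma coef_fps0 n : (0 : {fps R}) n = 0.
Proof. by rewrite /= if_same. Qed.

Lemma coef_fps1 n : (1 : {fps R}) n = (n == 0)%:R.
Proof. by rewrite /=; case: (n == 0). Qed.

Lemma fps_mul_order f g a b n :
  (forall i, (i < a)%N -> f i = 0) -> (forall i, (i < b)%N -> g i = 0) ->
  (n < a + b)%N -> (f * g) n = 0.
Proof.
move=> fa gb ltn; rewrite [LHS]big1 // => i _.
case: (ltnP i a) => [/fa->|le_ai]; first by rewrite mul0r.
rewrite gb ?mulr0 // ltn_subLR -1?ltnS ?ltn_ord //.
by apply: leq_trans ltn _; rewrite leq_add2r.
Qed.

Lemma fps_exp_order g k n : g 0 = 0 -> (n < k)%N -> (g ^+ k) n = 0.
Proof.
move=> g0; elim: k n => // k IHk n ltnk; rewrite exprS.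
by apply: (@fps_mul_order _ _ 1 k) => // -[].
Qed.

Lemma fps_comp_wide f g n N : g 0 = 0 -> (n < N)%N ->
  fps_comp f g n = \sum_(k < N) f k * (g ^+ k) n.
Proof.
move=> g0 ltnN; rewrite /= (big_ord_widen N (fun k => f k * (g ^+ k) n)) //.
rewrite [LHS]big_mkcond; apply: eq_bigr => k _; case: ltnP => // ltnk.
by rewrite fps_exp_order ?mulr0.
Qed.

(** For a polynomial, composition is evaluation in the algebra of power series and is multiplicative
    there; truncation carries this over to series in [fps_compM]. *)
Definition fps_horner g p : {fps R} := (map_poly (in_alg {fps R}) p).[g].

Lemma fps_hornerM g p1 p2 :
  fps_horner g (p1 * p2) = fps_horner g p1 * fps_horner g p2.
Proof. by rewrite /fps_horner rmorphM hornerM. Qed.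

Lemma coef_fps_horner g p n : g 0 = 0 ->
  fps_horner g p n = fps_comp (Fps (fun k => p`_k)) g n.
Proof.
move=> g0; rewrite (@fps_comp_wide _ _ _ (maxn n.+1 (size p))) ?leq_maxl //.
rewrite /fps_horner (@horner_coef_wide _ (maxn n.+1 (size p))); last first.
  by rewrite (leq_trans (size_poly _ _)) ?leq_maxr.
rewrite coef_fps_sum; apply: eq_bigr => k _.
by rewrite coef_map -[in_alg _ _ * _]/(p`_k *: 1 * g ^+ k) mulr_algl.
Qed.

Lemma eq_fps_comp f1 f2 g n : (forall i, (i <= n)%N -> f1 i = f2 i) ->
  fps_comp f1 g n = fps_comp f2 g n.
Proof. by move=> ef; apply: eq_bigr => i _; rewrite ef // -ltnS. Qed.

Lemma fps_compM f1 f2 g : g 0 = 0 ->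
  fps_comp (f1 * f2) g = fps_comp f1 g * fps_comp f2 g.
Proof.
move=> g0; apply/fpsP => n.
pose tr f := \poly_(i < n.+1) f i : {poly R}.
have trE f i : (i <= n)%N -> (tr f)`_i = f i by rewrite coef_poly ltnS => ->.
transitivity (fps_comp (Fps (fun k => (tr f1 * tr f2)`_k)) g n).
  apply: eq_fps_comp => i le_in /=; rewrite coefM; apply: eq_bigr => j _.
  rewrite !trE ?(leq_trans (leq_subr _ _)) //.
  by apply: leq_trans le_in; rewrite -ltnS.
rewrite -coef_fps_horner // fps_hornerM; apply: eq_bigr => i _.
congr (_ * _); rewrite coef_fps_horner //; apply: eq_fps_comp => j lej.
  by rewrite /= trE // (leq_trans lej) // -ltnS.
by rewrite /= trE // (leq_trans lej) // leq_subr.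
Qed.

Lemma fps_compD f1 f2 g : fps_comp (f1 + f2) g = fps_comp f1 g + fps_comp f2 g.
Proof.
apply/fpsP => n /=; rewrite -big_split; apply: eq_bigr => i _.
by rewrite mulrDl.
Qed.

Lemma fps_compZ c f g : fps_comp (c *: f) g = c *: fps_comp f g.
Proof.
apply/fpsP => n /=; rewrite big_distrr; apply: eq_bigr => i _.
by rewrite /= mulrA.
Qed.

Lemma fps_comp0 g : fps_comp 0 g = 0.
Proof.
apply/fpsP => n /=; rewrite [LHS]big1 ?if_same // => i _.
by rewrite if_same mul0r.
Qed.

Lemma fps_compN f g : fps_comp (- f) g = - fps_comp f g.
Proof. by rewrite -scaleN1r fps_compZ scaleN1r. Qed.

Lemma fps_compB f1 f2 g : fps_comp (f1 - f2) g = fps_comp f1 g - fps_comp f2 g.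
Proof. by rewrite fps_compD fps_compN. Qed.

Lemma fps_comp_sum I (r : seq I) (P : pred I) (F : I -> {fps R}) g :
  fps_comp (\sum_(i <- r | P i) F i) g = \sum_(i <- r | P i) fps_comp (F i) g.
Proof.
apply: (big_morph (fun f => fps_comp f g)) => [f1 f2|]; first exact: fps_compD.
exact: fps_comp0.
Qed.

Lemma fps_comp1 g : fps_comp 1 g = 1.
Proof.
apply/fpsP => n /=; rewrite big_ord_recl mul1r expr0 big1 ?addr0 // => i _.
by rewrite mul0r.
Qed.

Lemma fps_compX g : g 0 = 0 -> fps_comp (fpsX R) g = g.
Proof.
move=> g0; apply/fpsP => n; rewrite (@fps_comp_wide _ _ _ n.+2) //.
rewrite 2!big_ord_recl big1 /= ?mul0r ?mul1r ?addr0 ?add0r ?expr1 // => i _.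
by rewrite mul0r.
Qed.

Lemma fps_compXn f g k : g 0 = 0 -> fps_comp (f ^+ k) g = fps_comp f g ^+ k.
Proof.
move=> g0; elim: k => [|k IHk]; first by rewrite fps_comp1.
by rewrite !exprS fps_compM // IHk.
Qed.

Lemma fps_comp_const f g : fps_comp f g 0 = f 0.
Proof. by rewrite /= big_ord1 expr0 mulr1. Qed.

(** Up to degree n, f(g) is the finite sum of the f_j g^j, and substituting h commutes with sums and
    powers. *)
Lemma fps_compA f g h : g 0 = 0 -> h 0 = 0 ->
  fps_comp (fps_comp f g) h = fps_comp f (fps_comp g h).
Proof.
move=> g0 h0; apply/fpsP => n.
transitivity (fps_comp (\sum_(j < n.+1) f j *: g ^+ j) h n).
  apply: eq_fps_comp => i lein.
  by rewrite (@fps_comp_wide _ _ _ n.+1) // coef_fps_sum.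
rewrite fps_comp_sum coef_fps_sum; apply: eq_bigr => j _.
by rewrite fps_compZ fps_compXn.
Qed.

Lemma coef_fpsXM f n : (fpsX R * f) n = if n is n'.+1 then f n' else 0.
Proof.
case: n => [|n]; first by rewrite /= big_ord1 mul0r.
rewrite /= 2!big_ord_recl big1 /= ?mul0r ?mul1r ?add0r ?addr0 ?subn1 // => i _.
by rewrite mul0r.
Qed.

Lemma coef_fpsXnM f k n : (fpsX R ^+ k * f) n = if (n < k)%N then 0 else f (n -
  k)%N.
Proof.
elim: k n => [|k IHk] n; first by rewrite mul1r subn0.
by rewrite exprS -mulrA coef_fpsXM; case: n => // n; rewrite IHk ltnS subSS.
Qed.

Lemma coef_fpsXn k n : (fpsX R ^+ k) n = (n == k)%:R.
Proof.
rewrite -[_ ^+ k]mulr1 coef_fpsXnM coef_fps1 subn_eq0.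
by case: ltngtP.
Qed.

End FpsComp.

(** * Congruences modulo pi *)

(** The modulus is arbitrary because it will be pi, a power of pi, and the constant series pi in
    R[[X]]. *)
Definition congr_mod (R : comNzRingType) (m x y : R) := exists z, x = y + m * z.

Section Congruences.
Context (R : comNzRingType) (m : R).
Implicit Types x y z t : R.
Local Notation congr := (congr_mod m).

Lemma congr_refl x : congr x x.
Proof. by exists 0; rewrite mulr0 addr0. Qed.

Lemma congr_sym x y : congr x y -> congr y x.
Proof. by case=> z ->; exists (- z); ring. Qed.

Lemma congr_trans y x z : congr x y -> congr y z -> congr x z.
Proof. by case=> a -> [b ->]; exists (a + b); ring. Qed.

Lemma congrD x y z t : congr x y -> congr z t -> congr (x + z) (y + t).
Proof. by case=> a -> [b ->]; exists (a + b); ring. Qed.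

Lemma congrN x y : congr x y -> congr (- x) (- y).
Proof. by case=> a ->; exists (- a); ring. Qed.

Lemma congrB x y z t : congr x y -> congr z t -> congr (x - z) (y - t).
Proof. by move=> xy /congrN; apply: congrD. Qed.

Lemma congrM x y z t : congr x y -> congr z t -> congr (x * z) (y * t).
Proof. by case=> a -> [b ->]; exists (a * t + y * b + m * a * b); ring. Qed.

Lemma congrX n x y : congr x y -> congr (x ^+ n) (y ^+ n).
Proof.
move=> xy; elim: n => [|n IHn]; first exact: congr_refl.
by rewrite !exprS; apply: congrM.
Qed.

Lemma congr_sum I (r : seq I) (P : pred I) (E G : I -> R) :
  (forall i, P i -> congr (E i) (G i)) ->
  congr (\sum_(i <- r | P i) E i) (\sum_(i <- r | P i) G i).
Proof.
by move=> EG; apply: big_ind2 => //; [exact: congr_refl|move=> *;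
  exact: congrD].
Qed.

Lemma congr_prod I (r : seq I) (P : pred I) (E G : I -> R) :
  (forall i, P i -> congr (E i) (G i)) ->
  congr (\prod_(i <- r | P i) E i) (\prod_(i <- r | P i) G i).
Proof.
by move=> EG; apply: big_ind2 => //; [exact: congr_refl|move=> *;
  exact: congrM].
Qed.

End Congruences.

Section FpsCongr.
Context (R : comNzRingType) (pi : R).
Implicit Types f g h : {fps R}.
Local Notation congr := (congr_mod pi).
Local Notation congrs := (congr_mod (pi%:A : {fps R})).

Lemma coef_algM (c : R) f n : (c%:A * f) n = c * f n.
Proof. by rewrite mulr_algl. Qed.

Lemma coef_algXM (c : R) f k n : ((c%:A : {fps R}) ^+ k * f) n = c ^+ k * f n.
Proof.
elim: k n => [|k IHk] n; first by rewrite !mul1r.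
by rewrite !exprS -!mulrA coef_algM IHk.
Qed.

Lemma fps_congrP f g : (forall n, congr (f n) (g n)) <-> congrs f g.
Proof.
split=> [/choice[z fg]|[z ->] n].
  by exists (Fps z); apply/fpsP => n; rewrite fg coef_fpsD coef_algM.
by exists (z n); rewrite coef_fpsD coef_algM.
Qed.

Lemma congr_fps_comp f f' g g' :
  congrs f f' -> congrs g g' -> congrs (fps_comp f g) (fps_comp f' g').
Proof.
move=> ff' gg'; apply/fps_congrP => n; apply: congr_sum => k _.
apply: congrM; first exact: (fps_congrP _ _).2 ff' k.
by apply: (fps_congrP _ _).2; apply: congrX.
Qed.

End FpsCongr.

(** The properties of o_F on which the study of psi and of the digits rests. Completeness is phrased
    without a topology: x is the sum of the pi^k y_k when it agrees with every partial sum modulo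
    pi^n. *)
Record complete_dvr (R : comNzRingType) (pi : R) (q : nat) : Prop :=
  CompleteDvr {
  dvr_cancel : injective ( *%R pi);
  dvr_sep : forall x, (forall n, exists y, x = pi ^+ n * y) -> x = 0;
  dvr_complete : forall y : nat -> R,
    exists x, forall n, exists z, x = \sum_(k < n) pi ^+ k * y k + pi ^+ n * z;
  dvr_unit : forall x, (exists y, x * y = 1) <-> ~ congr_mod pi x 0;
  dvr_reps : exists s : 'I_q -> R,
    (forall i j, congr_mod pi (s i) (s j) -> i = j) /\
    forall x, exists i, congr_mod pi x (s i)
}.

Section DvrFacts.
Context (R : comNzRingType) (pi : R) (q : nat) (dvr : complete_dvr pi q).
Implicit Types f g h : {fps R}.
Local Notation congr := (congr_mod pi).
Local Notation congrs := (congr_mod (pi%:A : {fps R})).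

Lemma dvr_nunit1 : ~ congr 1 0.
Proof. by apply/(dvr_unit dvr); exists 1; rewrite mulr1. Qed.

Lemma dvr_card_gt1 : (1 < q)%N.
Proof.
have [s [_ s_surj]] := dvr_reps dvr.
have [[i i0] [j j1]] := (s_surj 0, s_surj 1).
case: q s i i0 j j1 {s_surj} => [|[|//]] s i; first by case: i.
move=> i0 j; rewrite [j]ord1 -[X in s X](ord1 i) => j1.
by case: dvr_nunit1; apply: congr_trans j1 (congr_sym i0).
Qed.

(* Translation by 1 permutes the residue classes, so that their sum S
   satisfies S = S + q. *)
Lemma dvr_card_congr0 : congr q%:R 0.
Proof.
have [s [s_inj s_surj]] := dvr_reps dvr.
have /choice[t st] : forall i, exists j, congr (s i + 1) (s j).
  by move=> i; apply: s_surj.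
have t_inj : injective t.
  move=> i j tij; apply: s_inj; have := congr_trans (st i) _.
  move=> /(_ _ (congr_sym _)); rewrite tij => /(_ _ (st j)) [z].
  by move=> /(congr1 (fun x => x - 1)) /= ez; exists z; rewrite addrK in ez;
    rewrite ez; ring.
have /(congrB (m := pi)) : congr (\sum_i (s i + 1)) (\sum_i s i).
  rewrite [X in congr _ X](reindex_inj t_inj) /=.
  by apply: congr_sum => i _; apply: st.
move=> /(_ _ _ (congr_refl _ (\sum_i s i))).
by rewrite big_split /= sumr_const card_ord addrAC !subrr add0r.
Qed.

Lemma fps_cancel : injective ( *%R (pi%:A : {fps R})).
Proof.
move=> f g fg; apply/fpsP => n; apply: (dvr_cancel dvr).
by rewrite -!coef_algM fg.
Qed.

Lemma fps_sep f : (forall n, exists g, f = pi%:A ^+ n * g) -> f = 0.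
Proof.
move=> fn; apply/fpsP => k; rewrite [RHS]/= if_same; apply: (dvr_sep dvr) => n.
by have [g ->] := fn n; exists (g k); rewrite coef_algXM.
Qed.

Lemma fps_complete (y : nat -> {fps R}) : exists x, forall n, exists z,
  x = \sum_(k < n) pi%:A ^+ k * y k + pi%:A ^+ n * z.
Proof.
have /choice[x xP] := fun m => dvr_complete dvr (fun k => y k m).
exists (Fps x) => n.
have /choice[z zP] := fun m => xP m n.
exists (Fps z); apply/fpsP => m.
rewrite coef_fpsD coef_algXM coef_fps_sum -[LHS]/(x m) zP.
by congr (_ + _); apply: eq_bigr => k _; rewrite coef_algXM.
Qed.

End DvrFacts.

(** * Traces and the kernel of psi *)

Section TraceUniqueness.
Context (B : comNzRingType) (A : set B).
Hypotheses (A1 : A 1) (AB : forall x y, A x -> A y -> A (x - y)).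
Hypothesis AM : forall x y, A x -> A y -> A (x * y).

Let A0 : A 0. Proof. by rewrite -(subrr 1); apply: AB. Qed.

Let AD x y : A x -> A y -> A (x + y).
Proof. by move=> Ax Ay; rewrite -[y]opprK; apply: AB => //; rewrite -sub0r;
  apply: AB. Qed.

Let mx_over m n (M : 'M[B]_(m, n)) := forall i j, A (M i j).

Let mx_overM m n k (M : 'M[B]_(m, n)) (N : 'M_(n, k)) :
  mx_over M -> mx_over N -> mx_over (M *m N).
Proof.
move=> MA NA i j; rewrite mxE; apply: big_ind => // l _; exact: AM.
Qed.

Let mx_over1 n : mx_over (1%:M : 'M[B]_n).
Proof. by move=> i j; rewrite mxE; case: (i == j). Qed.

Let row_inj n (e : 'I_n -> B) m (M N : 'M[B]_(n, m)) : free_basis A e ->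
  mx_over M -> mx_over N ->
  (\row_i e i) *m M = (\row_i e i) *m N -> M = N.
Proof.
move=> eA MA NA eMN; apply/matrixP => i j.
have [c [_ c_uniq]] := eA (\sum_k M k j * e k).
have MNj : \sum_k M k j * e k = \sum_k N k j * e k.
  have /matrixP/(_ 0 j) := eMN; rewrite !mxE => eMNj.
  transitivity (\sum_k (\row_i e i) 0 k * M k j).
    by apply: eq_bigr => k _; rewrite mxE mulrC.
  by rewrite eMNj; apply: eq_bigr => k _; rewrite mxE mulrC.
have cM : c = [ffun k => M k j].
  apply: c_uniq; split=> [k|]; first by rewrite ffunE.
  by apply: eq_bigr => k _; rewrite ffunE.
have cN : c = [ffun k => N k j].
  apply: c_uniq; split=> [k|]; first by rewrite ffunE.
  by rewrite MNj; apply: eq_bigr => k _; rewrite ffunE.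
by have := congr1 (fun f : {ffun _} => f i) (etrans (esym cM) cN);
  rewrite !ffunE.
Qed.

Let base_change n (e : 'I_n -> B) m (e' : 'I_m -> B) : free_basis A e ->
  exists P : 'M_(n, m), mx_over P /\ \row_i e' i = (\row_i e i) *m P.
Proof.
move=> eA; have /choice[c cP] : forall j, exists c : {ffun 'I_n -> B},
    (forall i, A (c i)) /\ e' j = \sum_i c i * e i.
  by move=> j; have [c [cP _]] := eA (e' j); exists c.
exists (\matrix_(i, j) c j i); split=> [i j|].
  by rewrite mxE; have [] := cP j.
apply/rowP => j; rewrite !mxE (cP j).2; apply: eq_bigr => i _.
by rewrite !mxE mulrC.
Qed.

Let traceE n (e : 'I_n -> B) (M : 'M[B]_n) b :
  (forall j, b * e j = \sum_i M i j * e i) ->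
  b *: (\row_i e i) = (\row_i e i) *m M.
Proof.
move=> bM; apply/rowP => j; rewrite !mxE bM; apply: eq_bigr => i _.
by rewrite mxE mulrC.
Qed.

(** If P and Q are the two base changes, uniqueness of coordinates gives P Q = 1 and M' = Q M P, so
    tr M' = tr (M P Q) = tr M; P and Q may be rectangular, hence the ranks are not compared. *)
Lemma is_trace_unique b t t' : is_trace A b t -> is_trace A b t' -> t = t'.
Proof.
move=> [n [e [M [eA MA /traceE bM ->]]]] [m [e' [M' [e'A M'A /traceE bM' ->]]]].
have [P [PA eP]] := base_change e' eA.
have [Q [QA eQ]] := base_change e e'A.
have PQ : P *m Q = 1%:M.
  apply: (row_inj eA); [exact: mx_overM|exact: mx_over1|].
  by rewrite mulmxA -eP -eQ mulmx1.
have -> : M' = Q *m (M *m P).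
  apply: (row_inj e'A) => //; first exact/mx_overM/mx_overM.
  by rewrite -bM' !mulmxA -eQ -bM -scalemxAl -eP.
by rewrite mxtrace_mulC -mulmxA PQ mulmx1.
Qed.

End TraceUniqueness.

(** * The endomorphism phi and its reduction modulo pi *)

Section LubinTatePhi.
Context (R : comNzRingType) (pi : R) (q : nat) (LT : lubin_tate pi q).
Implicit Types f g h : {fps R}.
Local Notation congr := (congr_mod pi).
Local Notation congrs := (congr_mod (pi%:A : {fps R})).
Local Notation phi := (lt_phi LT).

Lemma lt_act0 a : lt_act LT a 0 = 0.
Proof. exact: fm_const (lt_module LT) a. Qed.

Lemma lt_act1 a : lt_act LT a 1 = a.
Proof. exact: fm_linear (lt_module LT) a. Qed.

Lemma lt_act_comp a b : fps_comp (lt_act LT a) (lt_act LT b) = lt_act LT (a *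
  b).
Proof. exact: fm_mul (lt_module LT) a b. Qed.

Lemma lt_act_pi : congrs (lt_act LT pi) (fpsX R ^+ q).
Proof.
apply/fps_congrP => n; have [c ->] := lt_frobenius LT n.
by rewrite coef_fpsXn; exists c.
Qed.

Lemma lt_phiM f g : phi (f * g) = phi f * phi g.
Proof. exact/fps_compM/lt_act0. Qed.

Lemma lt_phiB f g : phi (f - g) = phi f - phi g.
Proof. exact: fps_compB. Qed.

Lemma lt_phiZ c f : phi (c *: f) = c *: phi f.
Proof. exact: fps_compZ. Qed.

Lemma lt_phi_sum I (r : seq I) (P : pred I) (F : I -> {fps R}) :
  phi (\sum_(i <- r | P i) F i) = \sum_(i <- r | P i) phi (F i).
Proof. exact: fps_comp_sum. Qed.

Lemma lt_phi1 : phi 1 = 1.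
Proof. exact: fps_comp1. Qed.

Lemma lt_phi0 : phi 0 = 0.
Proof. exact: fps_comp0. Qed.

Lemma lt_phiX : phi (fpsX R) = lt_act LT pi.
Proof. exact/fps_compX/lt_act0. Qed.

Lemma lt_phiA c : phi c%:A = c%:A.
Proof. by rewrite lt_phiZ lt_phi1. Qed.

Lemma coef_comp_Xn f m n : (0 < m)%N ->
  fps_comp f (fpsX R ^+ m) n = if (m %| n)%N then f (n %/ m)%N else 0.
Proof.
move=> m_gt0; rewrite /=.
have E (k : 'I_n.+1) : true -> f k * ((fpsX R ^+ m) ^+ k) n = if n == (m * k)%N
  then f k else 0.
  by move=> _; rewrite -exprM coef_fpsXn; case: eqP; rewrite ?mulr1 ?mulr0.
rewrite (eq_bigr _ E) -big_mkcond; case: ifP => [m_n|m_n].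
  have ltk : (n %/ m < n.+1)%N by rewrite ltnS leq_div.
  rewrite (big_pred1 (Ordinal ltk)) // => k.
  rewrite -[RHS]/(val k == (n %/ m)%N) -{1}(divnK m_n) mulnC eqn_pmul2l //.
rewrite big_pred0 // => k; apply: contraFF m_n => /eqP ->.
exact: dvdn_mulr.
Qed.

Lemma sum_comp_Xn (f : 'I_q -> {fps R}) n (lt_nq : (n %% q < q)%N) :
  (\sum_i fps_comp (f i) (fpsX R ^+ q) * fpsX R ^+ i) n =
    f (Ordinal lt_nq) (n %/ q)%N.
Proof.
have q_gt0 : (0 < q)%N by case: q lt_nq.
rewrite coef_fps_sum (bigD1 (Ordinal lt_nq)) // big1 => [|i ne_i].
  rewrite [LHS]addr0 mulrC coef_fpsXnM ltnNge leq_mod coef_comp_Xn //.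
  rewrite -[val _]/(n %% q)%N.
  have -> : (n - n %% q = n %/ q * q)%N by rewrite {1}(divn_eq n q) addnK.
  by rewrite dvdn_mull // mulnK.
rewrite mulrC coef_fpsXnM; case: ltnP => // le_in; rewrite coef_comp_Xn //.
case: ifP => // dvd; case/eqP: ne_i; apply: val_inj => /=.
by rewrite -(subnK le_in) -(divnK dvd) modnMDl modn_small.
Qed.

(** Modulo pi, phi is the substitution of X^q, so Euclidean division of the exponent by q separates
    the coordinates. *)
Lemma congr_sum_phi (f : 'I_q -> {fps R}) n (lt_nq : (n %% q < q)%N) :
  congr ((\sum_i phi (f i) * fpsX R ^+ i) n) (f (Ordinal lt_nq) (n %/ q)%N).
Proof.
rewrite -sum_comp_Xn; move: n {lt_nq}; apply/fps_congrP/congr_sum => i _.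
by apply: congrM (congr_refl _ _);
  apply: congr_fps_comp (congr_refl _ _) lt_act_pi.
Qed.

End LubinTatePhi.

(** * Freeness of R[[X]] over the image of phi, and the kernel of psi *)

Section PsiKernel.
Context (R : comNzRingType) (pi : R) (q : nat) (LT : lubin_tate pi q).
Hypothesis dvr : complete_dvr pi q.
Implicit Types f g h : {fps R}.
Local Notation congr := (congr_mod pi).
Local Notation congrs := (congr_mod (pi%:A : {fps R})).
Local Notation phi := (lt_phi LT).
Local Notation X := (fpsX R).
Local Notation expansion f := (\sum_(i < q) phi (f i) * X ^+ i).

Let q_gt0 : (0 < q)%N. Proof. exact/ltnW/(dvr_card_gt1 dvr). Qed.

Lemma phi_expansion_mod f : exists g : 'I_q -> {fps R}, congrs f (expansion g).
Proof.
exists (fun i => Fps (fun k => f (i + k * q)%N)).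
apply/fps_congrP => n; apply: congr_sym.
apply: congr_trans (congr_sum_phi _ _ (ltn_pmod n q_gt0)) _ => /=.
by rewrite addnC -divn_eq; apply: congr_refl.
Qed.

(** Successive approximation: the expansion modulo pi is repeated on the remainders, and the
    coordinates are summed pi-adically. *)
Lemma phi_expansion f : exists g : 'I_q -> {fps R}, f = expansion g.
Proof.
have /choice[s sP] := phi_expansion_mod.
have /choice[r rP] := sP.
(* [r f] is the error of the approximation [s f] divided by pi, so [u n] is the error after n steps
   divided by pi^n. *)
pose u n := iter n r f.
have /choice[g gP] := fun i => fps_complete dvr (fun k => s (u k) i).
exists g; apply/eqP; rewrite -subr_eq0; apply/eqP/(fps_sep dvr) => n.
have /choice[z zP] := fun i => gP i n.
have uP k : f = \sum_(j < k) pi%:A ^+ j * expansion (s (u j)) + pi%:A ^+ k * u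
  k.
  elim: k => [|k IHk]; first by rewrite big_ord0 add0r mul1r.
  by rewrite big_ord_recr /= {1}IHk {1}(rP (u k)) mulrDr exprSr mulrA addrA.
have phiX k x : phi (pi%:A ^+ k * x) = pi%:A ^+ k * phi x.
  by rewrite lt_phiM [X in X * _]fps_compXn ?lt_act0 // [fps_comp _ _]lt_phiA.
have gE : expansion g =
    \sum_(j < n) pi%:A ^+ j * expansion (s (u j)) + pi%:A ^+ n * expansion z.
  transitivity (\sum_i (\sum_(j < n) phi (pi%:A ^+ j * s (u j) i) * X ^+ i
      + phi (pi%:A ^+ n * z i) * X ^+ i)).
    apply: eq_bigr => i _; rewrite {1}zP -mulr_suml -mulrDl; congr (_ * _).
    by rewrite -lt_phi_sum; exact: fps_compD.
  rewrite big_split exchange_big; congr (_ + _); last first.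
    by rewrite mulr_sumr; apply: eq_bigr => i _; rewrite phiX mulrA.
  apply: eq_bigr => j _; rewrite mulr_sumr; apply: eq_bigr => i _.
  by rewrite phiX mulrA.
exists (u n - expansion z).
by rewrite mulrBr {1}(uP n) gE opprD addrACA subrr add0r.
Qed.

(** Modulo pi the coordinates can be read off and vanish; dividing them by pi gives another
    expansion of 0, so they are infinitely divisible by pi. *)
Lemma phi_expansion_inj (f : 'I_q -> {fps R}) :
  expansion f = 0 -> forall i, f i = 0.
Proof.
move=> f0 i.
have {f0} : forall n, exists g : 'I_q -> {fps R},
    (forall i, f i = pi%:A ^+ n * g i) /\ expansion g = 0.
  elim=> [|n [g [fg g0]]]; first by exists f; split=> // j; rewrite mul1r.
  have /choice[g' gg'] : forall j, exists x, g j = pi%:A * x.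
    move=> j; suff [x ->] : congrs (g j) 0 by exists x; rewrite add0r.
    apply/fps_congrP => k; rewrite [X in congr _ X]/= if_same.
    have lt_j : ((j + k * q) %% q < q)%N by rewrite ltn_pmod.
    have := congr_sum_phi LT g lt_j.
    rewrite g0 [X in congr X]/= if_same => /congr_sym.
    have -> : Ordinal lt_j = j by apply: val_inj;
      rewrite /= addnC modnMDl modn_small.
    by rewrite addnC divnMDl // divn_small // addn0.
  exists g'; split=> [j|]; first by rewrite fg gg' exprSr mulrA.
  apply: (fps_cancel dvr); rewrite mulr0 -[RHS]g0 mulr_sumr.
  by apply: eq_bigr => j _; rewrite gg' lt_phiM lt_phiA mulrA.
by move=> fn; apply: (fps_sep dvr) => n; have [g [-> _]] := fn n; exists (g i).
Qed.

Lemma phi_basis : free_basis (range phi) (fun i : 'I_q => X ^+ i).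
Proof.
move=> f; have [g gP] := phi_expansion f.
exists [ffun i => phi (g i)]; split.
  split=> [i|]; first by rewrite ffunE; exists (g i).
  by rewrite gP; apply: eq_bigr => i _; rewrite ffunE.
move=> c [cA fc].
have /choice[g' g'P] : forall i, exists x, phi x = c i.
  by move=> i; have [x _ <-] := cA i; exists x.
apply/ffunP => i; rewrite ffunE -g'P.
apply/eqP; rewrite -subr_eq0 -lt_phiB.
suff -> : g i - g' i = 0 by rewrite lt_phi0.
apply: (phi_expansion_inj (f := fun i => g i - g' i)).
transitivity (expansion g - \sum_i c i * X ^+ i); last by rewrite -gP -fc subrr.
rewrite -sumrB; apply: eq_bigr => j _.
by rewrite lt_phiB g'P mulrBl.
Qed.

Lemma phi_eq0 g : phi g = 0 -> g = 0.
Proof.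
move=> g0; pose i0 := Ordinal q_gt0.
pose f (i : 'I_q) := if i == i0 then g else 0.
have -> : g = f i0 by rewrite /f eqxx.
apply: phi_expansion_inj; apply: big1 => i _.
by rewrite /f; case: ifP; rewrite ?g0 ?lt_phi0 mul0r.
Qed.

Lemma trace0_psi_kernel f : is_trace (range phi) f 0 -> psi_kernel LT f.
Proof.
move=> f0; have tr0 : trace (range phi) f = 0.
  apply: xget_unique => // t ft; apply: is_trace_unique ft f0.
  - by exists 1; rewrite ?lt_phi1.
  - by move=> _ _ [x _ <-] [y _ <-]; exists (x - y); rewrite ?lt_phiB.
  - by move=> _ _ [x _ <-] [y _ <-]; exists (x * y); rewrite ?lt_phiM.
(* The value 0 does not come from the default of [xget]: it is the unique solution of pi phi(g) =
   0. *)
apply: xget_unique => [|g]; rewrite /= tr0.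
  by rewrite lt_phi0 scaler0.
rewrite -mulr_algl => eg; apply: phi_eq0; apply: (fps_cancel dvr).
by rewrite mulr0.
Qed.

(* f0 = [pi](X) / X sends X^j to phi(X) X^(j-1) for j > 0, so its trace is the
   coordinate phi(n 0) of f0 on X^0; hence phi(n 0) / pi - (q / pi) f0 has
   trace zero. *)
Lemma psi_kernel_unit : exists h, [/\ congr (h 0) 1 &
  forall g, psi_kernel LT (phi g * h)].
Proof.
pose w := lt_act LT pi; pose f0 : {fps R} := Fps (fun n => w n.+1).
have Xf0 : X * f0 = w.
  by apply/fpsP => -[|n]; rewrite coef_fpsXM // /w lt_act0.
have [n nP] := phi_expansion f0; pose i0 := Ordinal q_gt0.
(* Modulo pi, f0 is X^(q-1), whose coordinate on X^0 vanishes since q > 1. *)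
have [g0 g0P] : exists g0, n i0 = pi%:A * g0.
  suff [g0 g0P] : congrs (n i0) 0 by exists g0; rewrite g0P add0r.
  apply/fps_congrP => k; rewrite [X in congr _ X]/= if_same.
  have lt_k : (k * q %% q < q)%N by rewrite ltn_pmod.
  have := congr_sum_phi LT n lt_k; rewrite -nP mulnK //.
  have -> : Ordinal lt_k = i0 by apply: val_inj; rewrite /= modnMl.
  move=> /congr_sym/congr_trans; apply; rewrite /= /w.
  apply: congr_trans ((fps_congrP _ _ _).2 (lt_act_pi LT) _) _.
  rewrite coef_fpsXn; case: eqP => [kq|_]; last exact: congr_refl.
  have := congr1 (modn^~ q) kq.
  by rewrite -addn1 modnMDl modnn modn_small // (dvr_card_gt1 dvr).
(* phi preserves constant terms and X^i has none for i > 0, so [n i0] and f0 have the same constant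
   term pi. *)
have g00 : g0 0 = 1.
  apply: (dvr_cancel dvr); rewrite -coef_algM -g0P mulr1.
  rewrite -[RHS](lt_act1 LT) -[RHS]/(f0 0) nP coef_fps_sum (bigD1 i0) // big1
    => [|i ne_i0].
    by rewrite [RHS]addr0 [X ^+ _]expr0 mulr1 [RHS]fps_comp_const.
  rewrite mulrC coef_fpsXnM; have -> // : (0 < i)%N.
  by rewrite lt0n; exact: ne_i0.
have [c qc] : exists c, q%:R = pi * c.
  by have [c ->] := dvr_card_congr0 dvr; exists c; rewrite add0r.
exists (phi g0 - c%:A * f0); split.
  rewrite coef_fpsD -mulNr -scaleNr coef_algM fps_comp_const g00.
  by exists (- c); rewrite -[f0 0]/(w 1) /w lt_act1 mulrC.
move=> g; apply: trace0_psi_kernel.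
(* Column j holds the coordinates, before phi, of f0 X^j. *)
pose m (i j : 'I_q) : {fps R} :=
  if j == i0 then n i else if (i.+1 == j)%N then X else 0.
exists q, (fun i => X ^+ i).
exists (\matrix_(i, j) phi (g * (g0 *+ (i == j) - c%:A * m i j))); split.
- exact: phi_basis.
- by move=> i j; rewrite mxE; eexists.
- move=> j; have mE : f0 * X ^+ j = \sum_i phi (m i j) * X ^+ i.
    rewrite /m; have [->|j0] := eqVneq j i0; first by rewrite mulr1 -nP.
    have j_gt0 : (0 < j)%N by rewrite lt0n; move: j0; rewrite -val_eqE.
    have lt_j : (j.-1 < q)%N by rewrite (leq_ltn_trans (leq_pred _)).
    rewrite (bigD1 (Ordinal lt_j)) //= prednK // eqxx big1 => [|i ne_i].
      by rewrite addr0 lt_phiX -[lt_act LT pi]Xf0 -(prednK j_gt0) exprS mulrCA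
        mulrA.
    rewrite ifN ?lt_phi0 ?mul0r //; apply: contraNneq ne_i => ij.
    by apply/eqP/val_inj; rewrite /= -ij.
  transitivity (\sum_(i < q) phi g * ((phi g0 * X ^+ i) *+ (i == j)
      - c%:A * (phi (m i j) * X ^+ i))).
    rewrite -mulr_sumr sumrB -mulr_sumr -mE.
    have -> : \sum_(i < q) (phi g0 * X ^+ i) *+ (i == j) = phi g0 * X ^+ j.
      rewrite (bigD1 j) // big1 => [|i /negbTE ->//].
      by rewrite eqxx [LHS]addr0.
    by rewrite -!mulrA mulrBl -!mulrA.
  apply: eq_bigr => i _; rewrite mxE lt_phiM lt_phiB lt_phiM lt_phiA.
  rewrite !(mulrA, mulrBl, mulrBr); congr (_ - _).
  by case: (i == j); rewrite ?mulr0n ?lt_phi0 ?(mulr0, mul0r) // !mulr1n mulrA.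
(* The only diagonal entry of [m] that can be non-zero is [n i0] = pi g0, so the sum is q g0 - c pi
   g0, which is 0. *)
- suff m0 : \sum_(i < q) (g0 *+ (i == i) - c%:A * m i i) = 0.
    transitivity (\sum_(i < q) phi (g * (g0 *+ (i == i) - c%:A * m i i))).
      by rewrite -lt_phi_sum -mulr_sumr m0 mulr0 lt_phi0.
    by apply: eq_bigr => i _; rewrite mxE.
  have mE : \sum_(i < q) m i i = n i0.
    rewrite (bigD1 i0) // big1 => [|i ne_i0]; last by rewrite /m ifN // gtn_eqF.
    by rewrite [LHS]addr0 /m eqxx.
  rewrite sumrB -mulr_sumr mE g0P.
  rewrite (eq_bigr (fun=> g0)) => [|i _]; last by rewrite eqxx.
  rewrite sumr_const card_ord -mulr_natl.
  apply/eqP; rewrite subr_eq0; apply/eqP; rewrite mulrA; congr (_ * _).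
  have -> : (q%:R : {fps R}) = (q%:R : R)%:A by rewrite scaler_nat.
  by rewrite qc mulr_algl scalerA mulrC.
Qed.

End PsiKernel.

(** * Additivity of a |-> [a](X) to leading order *)

Section FormalAddition.
Context (R : comNzRingType).
Implicit Types f g h : {fps R}.

Definition mnm_deg1 (n : nat) : 'X_{1..1} := [multinom n | i < 1].

Lemma mdeg_mnm_deg1 n : mdeg (mnm_deg1 n) = n.
Proof. by rewrite mdegE big_ord1 mnmE. Qed.

Lemma mnm1_eq (m : 'X_{1..1}) n : (m == mnm_deg1 n) = (n == m ord0).
Proof.
apply/eqP/eqP => [->|->]; first by rewrite mnmE.
by apply/mnmP => i; rewrite mnmE ord1.
Qed.

(** A ring morphism that moves substitutions into a formal group law from multivariate polynomials
    to series in one variable, where orders are easy to estimate. *)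
Definition fps_of_mpoly (p : {mpoly R[1]}) : {fps R} :=
  mmap (in_alg {fps R}) (fun=> fpsX R) p.

Lemma coef_fps_of_mpoly p n : fps_of_mpoly p n = p@_(mnm_deg1 n).
Proof.
rewrite /fps_of_mpoly /mmap coef_fps_sum [in RHS](mpolyE p) raddf_sum.
apply: eq_bigr => m _; rewrite /mmap1 big_ord1 coef_algM coef_fpsXn.
by rewrite [RHS]mcoeffZ mcoeffX mnm1_eq.
Qed.

Lemma mcoeff_mfps_trunc n d (f : mfps n R) (m : 'X_{1..n}) :
  (mdeg m <= d)%N -> (mfps_trunc d f)@_m = f m.
Proof.
rewrite -ltnS => m_d; rewrite raddf_sum (bigD1 (BMultinom m_d)) //= big1 => [|k
  ne_k].
  by rewrite addr0 mcoeffZ mcoeffX eqxx mulr1.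
rewrite mcoeffZ mcoeffX; case: eqP => [km|_]; last by rewrite mulr0.
by case/eqP: ne_k; apply: val_inj.
Qed.

Definition fps_trunc d f := fps_of_mpoly (mfps_trunc d (mfps_of_fps f)).

Lemma coef_fps_trunc d f n : (n <= d)%N -> fps_trunc d f n = f n.
Proof.
move=> le_nd; rewrite coef_fps_of_mpoly mcoeff_mfps_trunc ?mdeg_mnm_deg1 //.
by rewrite /mfps_of_fps mnmE.
Qed.

(** Isolates the contribution of each monomial of G to the degree d coefficient of G(f, g). *)
Lemma mfps_subst2E (G : mfps 2 R) f g d :
  mfps_subst G [tuple mfps_of_fps f; mfps_of_fps g] (mnm_deg1 d) =
  \sum_(k : 'X_{1..2 < d.+1})
    G k * (fps_trunc d f ^+ k ord0 * fps_trunc d g ^+ k ord_max) d.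
Proof.
rewrite /mfps_subst mdeg_mnm_deg1.
rewrite [X in X@_ _](raddf_sum (comp_mpoly _)) (raddf_sum (mcoeff _)).
apply: eq_bigr => k _.
rewrite /= comp_mpolyZ mcoeffZ -coef_fps_of_mpoly comp_mpolyX.
rewrite big_ord_recl big_ord1 !tnth_mktuple.
rewrite /fps_of_mpoly rmorphM !rmorphXn.
by have -> : lift ord0 ord0 = ord_max :> 'I_2 by apply: val_inj.
Qed.

Lemma fps_exp_order_mul g a k n : (forall i, (i < a)%N -> g i = 0) ->
  (n < a * k)%N -> (g ^+ k) n = 0.
Proof.
move=> ga; elim: k n => [|k IHk] n; first by rewrite muln0.
by rewrite exprS mulnS => ltn; apply: fps_mul_order IHk ltn.
Qed.

(** Induction on the degree n: the terms f_k f^k with k < n vanish, and f^n has order at least 2n.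
    It is meant for [0], whose vanishing is not an axiom of [formal_module]. *)
Lemma fps_idem_comp_eq0 f :
  f 0 = 0 -> f 1 = 0 -> fps_comp f f = f -> f = 0.
Proof.
move=> f0 f1 ff; apply/fpsP => n; rewrite [RHS]/= if_same.
have [m] := ubnP n; elim: m n => // m IHm n lt_nm.
case: n lt_nm => // n lt_nm; rewrite -[in LHS]ff.
apply: big1 => -[[|k] /= lt_k] _; first by rewrite f0 mul0r.
move: lt_k; rewrite ltnS leq_eqVlt => /predU1P[[->]|lt_k]; last first.
  by rewrite IHm ?mul0r // (leq_trans lt_k).
rewrite (@fps_exp_order_mul _ 2) ?mulr0 // => [[|[|]]//|].
by rewrite mul2n -addnn ltnS leq_addl.
Qed.

End FormalAddition.

Section LubinTateAddition.
Context (R : comNzRingType) (pi : R) (q : nat) (LT : lubin_tate pi q).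
Local Notation congr := (congr_mod pi).
Local Notation act := (lt_act LT).

Lemma lt_act_zero : act 0 = 0.
Proof.
by apply: fps_idem_comp_eq0; rewrite ?lt_act0 ?lt_act1 // lt_act_comp mul0r.
Qed.

(* G(X, 0) = X and the coefficient of Y in G(0, Y) is 1, while the other
   monomials of G(X, Y) divisible by Y contribute in higher degree. *)
Lemma lt_act_add a b d : (0 < d)%N ->
  (forall i, (i < d)%N -> congr (act b i) 0) ->
  congr (act (a + b) d) (act a d + act b d).
Proof.
move=> d_gt0 b0; pose G := lt_law LT.
have actE c : act (a + c) d = \sum_(k : 'X_{1..2 < d.+1})
    G k * (fps_trunc d (act a) ^+ k ord0 * fps_trunc d (act c) ^+ k ord_max) d.
  rewrite -mfps_subst2E (fm_add (lt_module LT)).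
  by rewrite /mfps_of_fps mnmE.
(* Reading [a] as [a + 0] turns it into a sum over the same monomials, so the comparison is termwise
   and the monomials in X alone agree. *)
rewrite actE -[X in act X d + _](addr0 a) actE lt_act_zero.
have t0 : fps_trunc d (0 : {fps R}) = 0.
  apply/fpsP => n; rewrite coef_fps_of_mpoly /mfps_trunc raddf_sum.
  by rewrite coef_fps0 [LHS]big1 // => k _;
    rewrite /mfps_of_fps coef_fps0 scale0r raddf0.
(* [H] is [b] up to degree d with the coefficients below d, which are 0 modulo pi, made exactly 0,
   so that order estimates apply. *)
pose H := Fps (fun n => if (n < d)%N then 0 else fps_trunc d (act b) n).
have bH : congr_mod (pi%:A) (fps_trunc d (act b)) H.
  apply/fps_congrP => n /=; case: ltnP => [lt_nd|_]; last exact: congr_refl.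
  by rewrite coef_fps_trunc ?(ltnW lt_nd) //; apply: b0.
have H0 i : (i < d)%N -> H i = 0 by rewrite /= => ->.
have F0 i : (i < 1)%N -> fps_trunc d (act a) i = 0.
  by case: i => // _; rewrite coef_fps_trunc // lt_act0.
have U_d : (mdeg (U_(ord_max) : 'X_{1..2}) < d.+1)%N by rewrite mdeg1.
have -> : act b d = \sum_(k : 'X_{1..2 < d.+1})
    if k == BMultinom U_d then act b d else 0.
  by rewrite -big_mkcond big_pred1_eq.
rewrite -big_split; apply: congr_sum => k _.
rewrite -[X in congr_mod _ _ X]/(_ + _).
set F := fps_trunc d (act a) in F0 *; set B := fps_trunc d (act b) in bH *.
rewrite t0; case: eqP => [->|ne_k].
  have -> : bmnm (BMultinom U_d) ord0 = 0%N by rewrite mnm1E.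
  have -> : bmnm (BMultinom U_d) ord_max = 1%N by rewrite mnm1E eqxx.
  rewrite expr0 !expr1 !mul1r coef_fps0 mulr0 add0r.
  rewrite [G _](fgl_linear (fm_group (lt_module LT))) mul1r coef_fps_trunc //.
  exact: congr_refl.
rewrite addr0; have [->|j_gt0] := posnP (k ord_max).
  by rewrite !expr0; apply: congr_refl.
rewrite expr0n gtn_eqF // mulr0 coef_fps0 mulr0 -[X in congr_mod _ _ X](mulr0
  (G k)).
apply: congrM (congr_refl _ _) _.
suff <- : (F ^+ k ord0 * H ^+ k ord_max) d = 0.
  apply: (fps_congrP _ _ _).2; apply: congrM (congr_refl _ _) _.
  exact: congrX.
(* After substitution X^i Y^j has order at least i + d j, which exceeds d when j > 0 unless the
   monomial is Y. *)
apply: (fps_mul_order (a := 1 * k ord0) (b := d * k ord_max)) => [i|i|].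
- exact: fps_exp_order_mul.
- exact: fps_exp_order_mul.
rewrite mul1n; case kj: (k ord_max) j_gt0 => [//|[|j]] _.
  rewrite muln1 -[X in (X < _)%N]add0n ltn_add2r lt0n.
  apply: contra_notN ne_k => /eqP ki; apply: val_inj; apply/mnmP => i.
  rewrite mnm1E; have [->|->] : i = ord0 \/ i = ord_max.
    by case: i => -[|[|//]] lti; [left|right]; apply: val_inj.
    by rewrite ki.
  by rewrite kj eqxx.
rewrite (leq_trans _ (leq_addl _ _)) // -[X in (X < _)%N]muln1.
by rewrite ltn_pmul2l.
Qed.

End LubinTateAddition.

(** * Generating the locally constant functions *)

(** Such a W is the preimage of a submodule of the functions from R to R / pi. *)
Record closed_mod (R : comNzRingType) (pi : R) (W : set (R -> R)) : Prop :=
  ClosedMod {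
  closed_mod0 : W (fun=> 0);
  closed_modD : forall u v, W u -> W v -> W (fun a => u a + v a);
  closed_modZ : forall c u, W u -> W (fun a => c * u a);
  closed_mod_congr : forall u v, W u -> (forall a, congr_mod pi (u a) (v a)) ->
    W v
}.

Lemma closed_mod_sum (R : comNzRingType) (pi : R) (W : set (R -> R)) (I :
  finType)
    (P : pred I) (u : I -> R -> R) :
  closed_mod pi W -> (forall i, P i -> W (u i)) -> W (fun a => \sum_(i | P i) u
    i a).
Proof.
move=> cW uW; have -> : (fun a => \sum_(i | P i) u i a) = \sum_(i | P i) u i.
  by apply/funext => a; rewrite fct_sumE.
apply: big_ind => //; first exact: closed_mod0 cW.
exact: closed_modD cW.
Qed.

Section ModFunctions.
Context (R : comNzRingType) (pi : R) (q : nat) (LT : lubin_tate pi q).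
Hypothesis dvr : complete_dvr pi q.
Implicit Types f g h : {fps R}.
Local Notation congr := (congr_mod pi).
Local Notation congrs := (congr_mod (pi%:A : {fps R})).
Local Notation act := (lt_act LT).
Local Notation X := (fpsX R).

Definition lt_coef f n : R -> R := fun a => fps_comp f (act a) n.

Let q_gt0 : (0 < q)%N. Proof. exact/ltnW/(dvr_card_gt1 dvr). Qed.

Lemma lt_act_piX M : congrs (act (pi ^+ M)) (X ^+ (q ^ M)).
Proof.
elim: M => [|M IHM].
  by rewrite (fm_one (lt_module LT)); apply: congr_refl.
rewrite exprS -lt_act_comp.
apply: congr_trans (congr_fps_comp (lt_act_pi LT) IHM) _.
have X0 : (X ^+ (q ^ M)) 0 = 0.
  by rewrite coef_fpsXn eq_sym expn_eq0 gtn_eqF.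
by rewrite fps_compXn // fps_compX // -exprM -expnSr; apply: congr_refl.
Qed.

(** [pi^M] and [a] commute, both composites being [pi^M a], and [pi^M] is X^(q^M) modulo pi. *)
Lemma lt_coef_piX g M a :
  congrs (fps_comp (fps_comp g (act (pi ^+ M))) (act a))
         (fps_comp (fps_comp g (act a)) (X ^+ (q ^ M))).
Proof.
rewrite fps_compA ?lt_act0 // lt_act_comp mulrC -lt_act_comp.
rewrite -fps_compA ?lt_act0 //.
exact/congr_fps_comp/lt_act_piX/congr_refl.
Qed.

Lemma fps_decomp f : f = (f 0)%:A + X * Fps (fun n => f n.+1).
Proof.
apply/fpsP => -[|n]; rewrite coef_fpsD coef_fpsXM -[_%:A]mulr1 coef_algM.
  by rewrite mulr1 addr0.
by rewrite mulr0 add0r.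
Qed.

Lemma coef_mul_comp_Xn f g N j i : (j < N)%N ->
  (f * fps_comp g (X ^+ N)) (j + N * i)%N =
    \sum_(k < i.+1) f (j + N * (i - k))%N * g k.
Proof.
move=> lt_jN; have N_gt0 : (0 < N)%N by case: N lt_jN.
have XN0 : (X ^+ N) 0 = 0 by rewrite coef_fpsXn ltn_eqF.
elim: i g => [|i IHi] g; rewrite {1}(fps_decomp g) fps_compD fps_compM //
  fps_compX //;
  rewrite fps_compZ fps_comp1 mulrDr coef_fpsD mulrC coef_algM;
  rewrite mulrCA coef_fpsXnM.
  by rewrite big_ord1 subnn muln0 addn0 lt_jN addr0 mulrC.
have -> : (j + N * i.+1 < N)%N = false.
  by rewrite mulnS addnCA ltnNge leq_addr.
have -> : (j + N * i.+1 - N = j + N * i)%N by rewrite mulnS addnCA addKn.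
by rewrite IHi [RHS]big_ord_recl subn0 mulrC; congr (_ + _).
Qed.

(** The degree j + q^M i coefficient attached to f phi^M(g) is, modulo pi, a sum over k <= i whose
    last term is the desired product; the other terms are known by induction. *)
Lemma lt_coef_mul_mem W f : closed_mod pi W ->
  (forall g M n, W (lt_coef (f * fps_comp g (act (pi ^+ M.+1))) n)) ->
  forall g i j, W (fun a => lt_coef f j a * lt_coef g i a).
Proof.
(* The index j stays free: the terms to subtract have smaller g-index but larger f-index j + N (i -
   k). *)
move=> cW fW g i; have [m] := ubnP i; elim: m i => // m IHm i lt_im j.
(* The exponent only has to make N exceed j and come from a positive power of pi, hence from the
   image of phi. *)
pose N := (q ^ j.+1)%N.
have lt_jN : (j < N)%N.
  by apply: ltnW; apply: ltn_expl; apply: dvr_card_gt1 dvr.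
pose u (k : 'I_i) a := -1 * (lt_coef f (j + N * (i - k))%N a * lt_coef g k a).
have uW k : W (u k).
  by apply: (closed_modZ cW); apply: IHm; apply: leq_trans (ltn_ord k) _.
have uS := closed_mod_sum (P := predT) cW (fun k _ => uW k).
have := closed_modD cW (fW g j (j + N * i)%N) uS.
move=> /(closed_mod_congr cW); apply=> a; rewrite /u -mulr_sumr mulN1r.
rewrite -[X in congr _ X](addrK (\sum_(k < i) lt_coef f (j + N * (i - k)) a *
  lt_coef g k a)).
apply: congrB (congr_refl _ _).
rewrite {1}/lt_coef fps_compM ?lt_act0 //.
have E := congrM (congr_refl _ (fps_comp f (act a))) (lt_coef_piX g j.+1 a).
apply: congr_trans ((fps_congrP _ _ _).2 E _) _.
rewrite coef_mul_comp_Xn // big_ord_recr /= subnn muln0 addn0 addrC.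
exact: congr_refl.
Qed.

(** The span modulo pi of all c_{f,n}, as the intersection of the closed sets containing them: span
    induction is then mere application. *)
Definition lt_coef_span : set (R -> R) := fun u =>
  forall W, closed_mod pi W -> (forall f n, W (lt_coef f n)) -> W u.

Lemma lt_coef_span_coef f n : lt_coef_span (lt_coef f n).
Proof. by move=> W _; apply. Qed.

Lemma lt_coef_span_closed : closed_mod pi lt_coef_span.
Proof.
split=> [W cW|u v uS vS W cW coefW|c u uS W cW coefW|u v uS uv W cW coefW].
- by move=> _; apply: closed_mod0 cW.
- by apply: (closed_modD cW); [exact: uS|exact: vS].
- by apply: (closed_modZ cW); exact: uS.
- by apply: (closed_mod_congr cW) uv; exact: uS.
Qed.

(** Span induction in each factor reduces to two generators, the case of [lt_coef_mul_mem] where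
    every series is allowed. *)
Lemma lt_coef_spanM u v :
  lt_coef_span u -> lt_coef_span v -> lt_coef_span (fun a => u a * v a).
Proof.
have cS := lt_coef_span_closed.
have cSM v' : closed_mod pi (fun u => lt_coef_span (fun a => u a * v' a)).
  split=> [|u1 u2 S1 S2|c u1 S1|u1 u2 S1 u12].
  - apply: (closed_mod_congr cS (closed_mod0 cS)) => a.
    by rewrite mul0r; apply: congr_refl.
  - apply: (closed_mod_congr cS (closed_modD cS S1 S2)) => a.
    by rewrite mulrDl; apply: congr_refl.
  - apply: (closed_mod_congr cS (closed_modZ cS c S1)) => a.
    by rewrite mulrA; apply: congr_refl.
  - apply: (closed_mod_congr cS S1) => a.
    exact: congrM (u12 a) (congr_refl _ _).
move=> uS vS; apply: (uS _ (cSM v)) => f n.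
have -> : (fun a => lt_coef f n a * v a) = (fun a => v a * lt_coef f n a).
  by apply/funext => a; rewrite mulrC.
apply: (vS _ (cSM (lt_coef f n))) => g i.
by apply: lt_coef_mul_mem => // *; apply: lt_coef_span_coef.
Qed.

Lemma lt_coef_span_const c : lt_coef_span (fun=> c).
Proof.
have cS := lt_coef_span_closed.
apply: (closed_mod_congr cS (closed_modZ cS c (lt_coef_span_coef 1 0))) => a.
by rewrite /lt_coef fps_comp1 coef_fps1 mulr1; apply: congr_refl.
Qed.

Lemma lt_coef_span_prod (I : finType) (P : pred I) (u : I -> R -> R) :
  (forall i, P i -> lt_coef_span (u i)) ->
  lt_coef_span (fun a => \prod_(i | P i) u i a).
Proof.
move=> uS; have -> : (fun a => \prod_(i | P i) u i a) = \prod_(i | P i) u i.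
  by apply/funext => a; rewrite fct_prodE.
apply: big_ind => //; first exact: lt_coef_span_const.
exact: lt_coef_spanM.
Qed.

Definition lt_digit L : R -> R := lt_coef X (q ^ L).

(** Modulo pi, [pi^L c] is [c](X^(q^L)), with leading term c X^(q^L), and in that degree the formal
    sum is the ordinary one. *)
Lemma lt_digit_shift L a c : congr (lt_digit L (a + pi ^+ L * c)) (lt_digit L a
  + c).
Proof.
rewrite /lt_digit /lt_coef !fps_compX ?lt_act0 //.
have qL : (0 < q ^ L)%N by rewrite expn_gt0 q_gt0.
have cE : congrs (act (pi ^+ L * c)) (fps_comp (act c) (X ^+ (q ^ L))).
  rewrite mulrC -lt_act_comp;
    exact: congr_fps_comp (congr_refl _ _) (lt_act_piX L).
have {}cE := (fps_congrP _ _ _).2 cE.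
apply: (congr_trans (@lt_act_add _ _ _ LT a _ _ qL _)) => [i lt_i|].
  apply: congr_trans (cE i) _;
    rewrite coef_comp_Xn // divn_small // lt_act0 if_same.
  exact: congr_refl.
apply: congrD (congr_refl _ _) _; apply: congr_trans (cE _) _.
by rewrite coef_comp_Xn // dvdnn divnn qL lt_act1; apply: congr_refl.
Qed.

(* With e = lt_digit L, a function w modulo pi^(L+1) is the sum over residues s
   of [e(a) = s] * w(a + pi^L (s - e(a))), where the second factor only depends
   on a modulo pi^L. *)
Lemma lt_coef_span_locally_const L w :
  (forall a c, congr (w (a + pi ^+ L * c)) (w a)) -> lt_coef_span w.
Proof.
have cS := lt_coef_span_closed.
elim: L w => [|L IHL] w wL.
  apply: (closed_mod_congr cS (lt_coef_span_const (w 0))) => a.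
  by apply: congr_sym; have := wL 0 a; rewrite add0r mul1r.
have [s [s_inj s_surj]] := dvr_reps dvr.
pose e := lt_digit L.
have /choice[r rP] : forall ij : 'I_q * 'I_q, exists y,
    ij.1 != ij.2 -> (s ij.1 - s ij.2) * y = 1.
  move=> [i j]; have [->|ne_ij] := eqVneq i j; first by exists 0.
  have [|y yP] := (dvr_unit dvr (s i - s j)).2; last by exists y => _.
  move=> sij; case/eqP: ne_ij; apply: s_inj.
  have := congrD sij (congr_refl pi (s j)).
  by rewrite subrK add0r.
(* The Lagrange interpolation product in e(a): modulo pi it is 1 when e(a) is s_i and 0 when e(a) is
   another representative. *)
pose del i a := \prod_(j | j != i) ((e a - s j) * r (i, j)).
pose ws i a := w (a + pi ^+ L * (s i - e a)).
have delS i : lt_coef_span (del i).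
  apply: lt_coef_span_prod => j _; apply: lt_coef_spanM (lt_coef_span_const _).
  exact: (closed_modD cS (lt_coef_span_coef _ _) (lt_coef_span_const _)).
have wsS i : lt_coef_span (ws i).
  apply: IHL => a c; rewrite /ws.
  have [z ez] := lt_digit_shift L a c.
  rewrite [e (a + _)]ez -/(e a).
  (* The shift of a by pi^L c and the resulting shift of the digit by c cancel up to a multiple of
     pi^(L+1). *)
  have -> : a + pi ^+ L * c + pi ^+ L * (s i - (e a + c + pi * z)) =
      a + pi ^+ L * (s i - e a) + pi ^+ L.+1 * (- z) by rewrite exprS; ring.
  exact: wL.
have := closed_mod_sum (P := predT) cS (fun i _ => lt_coef_spanM (delS i) (wsS
  i)).
move=> /(closed_mod_congr cS); apply=> a.
have [i ei] := s_surj (e a).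
rewrite (bigD1 i) //= -[X in congr _ X]addr0; apply: congrD.
  rewrite -[X in congr _ X]mul1r; apply: congrM.
    have <- : \prod_(j : 'I_q | j != i) 1 = 1 :> R by rewrite big1.
    apply: congr_prod => j ne_ji; rewrite -(rP (i, j)) /= 1?eq_sym //.
    by apply: congrM (congr_refl _ _); apply: congrB (congr_refl _ _).
  rewrite /ws; case: ei => z ->.
  have -> : a + pi ^+ L * (s i - (s i + pi * z)) = a + pi ^+ L.+1 * (- z).
    by rewrite exprS; ring.
  exact: wL.
rewrite -[X in congr _ X](_ : \sum_(j : 'I_q | j != i) 0 = 0);
  last by rewrite big1.
apply: congr_sum => j ne_ji; rewrite -[X in congr _ X](mul0r (ws j a)).
apply: congrM (congr_refl _ _); rewrite /del (bigD1 i) 1?eq_sym //=.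
rewrite -[X in congr _ X](mul0r (\prod_(k | (k != j) && (k != i)) ((e a - s k)
  * r (j, k)))).
apply: congrM (congr_refl _ _); rewrite -[X in congr _ X](mul0r (r (j, i))).
apply: congrM (congr_refl _ _); rewrite -[X in congr _ X](subrr (s i)).
exact: congrB ei (congr_refl _ _).
Qed.

(** For h in ker psi with h(0) = 1 modulo pi, c_{h,0} is the constant h(0), so the products c_{h,0}
    c_{g,i} put every c_{g,i} in W. *)
Lemma psi_kernel_locally_const W L w : closed_mod pi W ->
  (forall f n, psi_kernel LT f -> W (lt_coef f n)) ->
  (forall a c, congr (w (a + pi ^+ L * c)) (w a)) -> W w.
Proof.
move=> cW kerW wL; apply: (lt_coef_span_locally_const wL) => // g i.
have [h [h0 hker]] := psi_kernel_unit LT dvr.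
suff hW : W (fun a => lt_coef h 0 a * lt_coef g i a).
  apply: (closed_mod_congr cW hW) => a; rewrite -[X in congr _ X]mul1r.
  by apply: congrM (congr_refl _ _); rewrite /lt_coef fps_comp_const.
apply: lt_coef_mul_mem cW _ _ _ _ => g' M n.
apply: kerW; rewrite mulrC.
have -> : fps_comp g' (act (pi ^+ M.+1)) = lt_phi LT (fps_comp g' (act (pi ^+
  M))).
  by rewrite /lt_phi fps_compA ?lt_act0 // lt_act_comp exprSr.
exact: hker.
Qed.

End ModFunctions.

(** * The ring of integers is a complete discrete valuation ring *)

Section PadicDivisibility.
Context (p : nat) (p_prime : prime p).
Local Notation Zp := 'Z_[p_prime].
Implicit Types (x y z : Zp) (n : nat).

Lemma residue_atE x m n : (m <= n)%N -> residue_at x m = (residue_at x n :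
  nat)%:R.
Proof.
elim: n => [|n IHn].
  by rewrite leqn0 => /eqP ->; rewrite natr_Zp.
rewrite leq_eqVlt => /predU1P[->|le_mn]; first by rewrite natr_Zp.
rewrite IHn // residue_atP val_Zp_nat ?expp_gt1 //.
rewrite -[LHS]Zp_nat_mod ?expp_gt1 // modn_dvdm ?Zp_nat_mod ?expp_gt1 //.
exact: dvdn_exp2l.
Qed.

Lemma residue_at_natr k n : residue_at (k%:R : Zp) n = k%:R.
Proof. by elim: k => // k IHk;
  rewrite -natr1 -[LHS]/(residue_at k%:R n + 1) IHk natr1. Qed.

Lemma residue_atM x y n : residue_at (x * y) n = residue_at x n * residue_at y
  n.
Proof. by []. Qed.

Lemma residue_atB x y n : residue_at (x - y) n = residue_at x n - residue_at y
  n.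
Proof. by []. Qed.

Lemma residue_at0_dvd x n : residue_at x n = 0 -> exists y, x = p%:R ^+ n.+1 *
  y.
Proof.
(* Division by p^(n+1) loses n+1 digits of precision, hence the shift of the level. *)
move=> xn0; pose X k := residue_at x (k + n.+1).
have p_gt0 := prime_gt0 p_prime.
have pn_gt0 : (0 < p ^ n.+1)%N by rewrite expn_gt0 p_gt0.
have X_dvd k : (p ^ n.+1 %| X k)%N.
  by rewrite -residue_at_eq0 ?xn0 // addnS ltnW // ltnS leq_addl.
have coh : Zp_coherent (fun k => ((X k : nat) %/ p ^ n.+1)%N%:R : 'Z_(p ^
  k.+1)).
  move=> k; rewrite val_Zp_nat ?expp_gt1 //.
  rewrite natr_Zp_mod //.
  have XE : X k = ((X k.+1 : nat) %% p ^ (k + n.+1).+1)%N :> nat.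
    by rewrite [X k]residue_atP val_Zp_nat ?expp_gt1.
  move: (X k : nat) (X k.+1 : nat) XE => a b ab.
  rewrite [in RHS](divn_eq b (p ^ (k + n.+1).+1)) -ab -addSn expnD mulnA
    divnMDl // natrD natrM.
  by rewrite pchar_Zp ?(expp_gt1 p_prime) // mulr0 add0r.
exists (PadicInt p_prime coh); apply/padic_intP => k.
rewrite residue_atM -natrX residue_at_natr /= -natrM mulnC divnK //.
by apply: residue_atE; apply: leq_addr.
Qed.

Lemma padic_valuation x : x != 0 ->
  exists n y, x = p%:R ^+ n * y /\ residue_at y 0 != 0.
Proof.
move=> x0; have ex : exists n, residue_at x n != 0.
  apply: contrapT => /forallNP x0'; case/eqP: x0; apply/padic_intP => n.
  by apply/eqP/negP => /negP/x0'.
case: (ex_minnP ex) => n xn n_min.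
have [y xy] : exists y, x = p%:R ^+ n * y.
  case: n xn n_min => [|n] xn n_min; first by exists x; rewrite mul1r.
  apply: residue_at0_dvd; apply/eqP; apply: contraT => /n_min.
  by rewrite ltnn.
exists n, y; split=> //; apply: contraNneq xn => /residue_at0_dvd[z yz].
by rewrite xy yz mulrA expr1 -exprSr residue_atM -natrX residue_at_natr
  pchar_Zp ?mul0r ?expp_gt1.
Qed.

Lemma padic_series (c : nat -> Zp) : exists z, forall n, exists t,
  z = \sum_(k < n) p%:R ^+ k * c k + p%:R ^+ n * t.
Proof.
pose S n := \sum_(k < n) p%:R ^+ k * c k.
(* Level n is modulo p^(n+1), where the terms from index n+1 on vanish. *)
have coh : Zp_coherent (fun n => residue_at (S n.+1) n).
  move=> n; rewrite -residue_atP /S [in RHS]big_ord_recr /=.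
  rewrite -[RHS]/(residue_at _ n + residue_at (_ ^+ _ * _) n).
  by rewrite residue_atM -natrX residue_at_natr pchar_Zp ?expp_gt1 // mul0r
    addr0.
exists (PadicInt p_prime coh) => -[|n].
  by exists (PadicInt p_prime coh); rewrite big_ord0 add0r mul1r.
have [t tP] : exists t, PadicInt p_prime coh - S n.+1 = p%:R ^+ n.+1 * t.
  by apply: residue_at0_dvd; rewrite residue_atB subrr.
by exists t; rewrite -tP addrC subrK.
Qed.

(** Bezout for p and the residue of y. An inverse modulo p is enough to see that y is a unit in o_F,
    where pi divides p. *)
Lemma padic_inv_mod y : residue_at y 0 != 0 -> exists k z, k * y = 1 + p%:R * z.
Proof.
set m := residue_at y 0 => m0.
have cop : coprime p m.
  rewrite prime_coprime // -[X in (X %| _)%N]expn1.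
  by rewrite -(residue_at_eq0 y (leqnn 0)).
have m_gt0 : (0 < m)%N by rewrite lt0n; exact: m0.
have [[k l] /= klE] := coprimeP _ m_gt0 (etrans (coprime_sym _ _) cop).
have {}klE : (k * m = l * p + 1)%N.
  have lt_lk : (l * p < k * m)%N by rewrite -subn_gt0 klE.
  by move/ltnW/subnKC: lt_lk => <-; congr (_ + _)%N.
have [z yz] : exists z, y - (m : nat)%:R = p%:R ^+ 1 * z.
  by apply: residue_at0_dvd; rewrite residue_atB residue_at_natr natr_Zp subrr.
exists k%:R, (l%:R + k%:R * z).
have -> : y = (m : nat)%:R + p%:R * z by rewrite expr1 in yz;
  rewrite -yz addrC subrK.
have := congr1 (fun n => n%:R : Zp) klE.
rewrite natrM natrD natrM mulrDr => ->; ring.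
Qed.

End PadicDivisibility.

Lemma sum_pow_split (R : comNzRingType) (c : nat -> R) x k n : (k < n)%N ->
  exists t, \sum_(i < n) c i * x ^+ i = \sum_(i < k) c i * x ^+ i + x ^+ k * (c
    k + x * t).
Proof.
elim: n => // n IHn; rewrite ltnS leq_eqVlt big_ord_recr /= =>
  /predU1P[->|lt_kn].
  by exists 0; rewrite mulr0 addr0 mulrC.
have [t ->] := IHn lt_kn; exists (t + c n * x ^+ (n - k.+1)).
have -> : x ^+ n = x ^+ k * (x * x ^+ (n - k.+1)).
  by rewrite -exprS -exprD addnS -addSn subnKC.
by ring.
Qed.

(** * Integral equations over Z_p *)

Section RingOfIntegersIntegral.
Context (p : nat) (p_prime : prime p) (F : fieldExtType 'Q_[p_prime]).
Local Notation Zp := 'Z_[p_prime].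

Lemma integer_valD (x y : 'o_[F]) :
  integer_val (x + y) = integer_val x + integer_val y.
Proof. exact: (rmorphD val). Qed.

Lemma integer_valM (x y : 'o_[F]) :
  integer_val (x * y) = integer_val x * integer_val y.
Proof. exact: (rmorphM val). Qed.

Lemma integer_valX (x : 'o_[F]) n : integer_val (x ^+ n) = integer_val x ^+ n.
Proof. exact: (rmorphXn val). Qed.

Fact Zp_embed_integer (z : Zp) : Zp_embed F z \in @integer p p_prime F.
Proof. by apply/asboolP; apply: integral_id. Qed.

Definition oF_embed (z : Zp) : 'o_[F] := RingOfIntegers (Zp_embed_integer z).

Fact oF_embed_zmod : zmod_morphism oF_embed.
Proof. by move=> x y; apply: val_inj; rewrite /= rmorphB. Qed.
Fact oF_embed_monoid : monoid_morphism oF_embed.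
Proof. by split=> [|x y]; apply: val_inj; rewrite /= ?rmorph1 ?rmorphM. Qed.
HB.instance Definition _ := GRing.isZmodMorphism.Build Zp 'o_[F] oF_embed
  oF_embed_zmod.
HB.instance Definition _ := GRing.isMonoidMorphism.Build Zp 'o_[F] oF_embed
  oF_embed_monoid.

Lemma Zp_embed_eq0 (z : Zp) : (Zp_embed F z == 0) = (z == 0).
Proof. by rewrite /Zp_embed scaler_eq0 oner_eq0 orbF tofrac_eq0. Qed.

Lemma oF_embed_eq0 (z : Zp) : (oF_embed z == 0) = (z == 0).
Proof. by rewrite -Zp_embed_eq0. Qed.

Lemma oF_mulrI (x : 'o_[F]) : x != 0 -> injective ( *%R x).
Proof.
move=> x0 y z /(congr1 val); rewrite !rmorphM => xyz; apply: val_inj.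
by apply: mulfI xyz; rewrite -[0]/(val (0 : 'o_[F])) (inj_eq val_inj).
Qed.

Lemma oF_integral_eq (x : 'o_[F]) : exists r : {poly Zp}, r \is monic /\
  \sum_(i < size r) oF_embed r`_i * x ^+ i = 0.
Proof.
have /asboolP[r r_monic /rootP rx] := valP x.
exists r; split=> //; apply: val_inj; rewrite raddf_sum -[RHS]rx.
rewrite (@horner_coef_wide _ (size r)) ?size_poly //.
by apply: eq_bigr => i _; rewrite coef_map [LHS]rmorphM [X in _ * X]rmorphXn.
Qed.

(** Take d to be the lowest non-zero coefficient of a monic equation of x, and divide the equation
    by the power of x in front of it. *)
Lemma oF_dvd_Zp (x : 'o_[F]) : x != 0 ->
  exists d y, d != 0 /\ oF_embed d = x * y.
Proof.
move=> x0; have [r [r_monic rx]] := oF_integral_eq x.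
have ex : exists i, r`_i != 0.
  by exists (size r).-1; rewrite -[r`__]/(lead_coef r) (monicP r_monic)
    oner_eq0.
case: (ex_minnP ex) => k rk k_min.
have lt_k : (k < size r)%N by rewrite ltnNge;
  apply: contra rk => /(nth_default 0) ->.
have [t] := sum_pow_split (fun i => oF_embed r`_i) x lt_k.
rewrite rx big1 => [|i _]; last first.
  have [->|/k_min] := eqVneq (r`_i) 0; first by rewrite rmorph0 mul0r.
  by rewrite leqNgt ltn_ord.
rewrite add0r -{1}(mulr0 (x ^+ k)) => /oF_mulrI rkt.
exists r`_k, (- t); split=> //; rewrite mulrN.
apply/eqP; rewrite -addr_eq0; apply/eqP/esym/rkt.
elim: k {lt_k k_min rk rkt} => [|k IHk]; first by rewrite oner_eq0.
by apply: contra x0 => /eqP; rewrite exprS -{1}(mulr0 x) => xx;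
  apply: contraNT IHk => x0; apply/eqP/(oF_mulrI x0).
Qed.

End RingOfIntegersIntegral.

Section RingOfIntegersDvr.
Context (p : nat) (p_prime : prime p) (F : fieldExtType 'Q_[p_prime]).
Context (pi : 'o_[F]) (q : nat).
Hypotheses (unif : uniformizer pi) (card_q : residue_card pi q).
Local Notation Zp := 'Z_[p_prime].
Local Notation oF := ('o_[F]).
Local Notation congr := (congr_mod pi).

Lemma oF_unit (x : oF) : (exists y, x * y = 1) <-> ~ congr x 0.
Proof.
have E : (~ exists y, x * y = 1) <-> congr x 0.
  have /seteqP[/(_ x) sub /(_ x) sup] := unif; split=> [/sub[y _ <-]|[z xz]].
    by exists y; rewrite add0r.
  by apply: sup; exists z; rewrite // xz add0r.
by split=> [xu /E //|xn]; apply: contrapT => /E.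
Qed.

Lemma oF_not_congr1 : ~ congr 1 0.
Proof. by apply/oF_unit; exists 1; rewrite mulr1. Qed.

Lemma padic_p_neq0 : (p%:R : Zp) != 0.
Proof.
apply/eqP => /(congr1 (fun x : Zp => residue_at x 1)).
rewrite residue_at_natr => /(congr1 (@nat_of_ord _)) /=.
rewrite val_Zp_nat ?expp_gt1 // modn_small; last first.
  by rewrite -[X in (X < _)%N]expn1 ltn_exp2l // prime_gt1.
by move=> p0; move: p_prime; rewrite p0.
Qed.

(** Otherwise p has an integral inverse y, and p^n times the monic equation of y, of degree n, shows
    that p divides 1 in Z_p. *)
Lemma oF_p_congr0 : congr p%:R 0.
Proof.
apply: contrapT => /oF_unit[y py1].
have [r [r_monic ry]] := oF_integral_eq y.
have [n sr] : exists n, size r = n.+1.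
  by exists (size r).-1; rewrite prednK // size_poly_gt0 monic_neq0.
rewrite sr in ry.
have e0 : \sum_(i < n.+1) r`_i * p%:R ^+ (n - i) = 0 :> Zp.
  apply/eqP; rewrite -(oF_embed_eq0 F) rmorph_sum; apply/eqP.
  transitivity (p%:R ^+ n * \sum_(i < n.+1) oF_embed F r`_i * y ^+ i).
    rewrite mulr_sumr; apply: eq_bigr => i _;
      rewrite rmorphM rmorphXn rmorph_nat.
    have le_in : (i <= n)%N by rewrite -ltnS.
    rewrite -[X in p%:R ^+ X * (_ * _)](subnK le_in) exprD.
    by rewrite mulrCA -mulrA -exprMn py1 expr1n mulr1.
  by rewrite ry mulr0.
have lr : r`_n = 1 by have /monicP := r_monic; rewrite /lead_coef sr.
move: e0; rewrite big_ord_recr /= lr subnn mul1r => e0.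
have [t tE] : exists t, \sum_(i < n) r`_i * p%:R ^+ (n - i) = p%:R * t :> Zp.
  exists (\sum_(i < n) r`_i * p%:R ^+ (n - i).-1); rewrite mulr_sumr.
  by apply: eq_bigr => i _; rewrite mulrCA -exprS prednK // subn_gt0.
have /(congr1 (fun x : Zp => residue_at x 0)) := e0.
rewrite tE -[residue_at (_ + _) 0]/(residue_at (p%:R * t) 0 + 1) residue_atM
  residue_at_natr.
have -> : p%:R = 0 :> 'Z_(p ^ 1) by rewrite -[X in X%:R](expn1 p) pchar_Zp
  ?expp_gt1.
by rewrite mul0r add0r => /eqP; rewrite oner_eq0.
Qed.

Lemma oF_pi_neq0 : pi != 0.
Proof.
apply/eqP => pi0; have [z] := oF_p_congr0; rewrite pi0 mul0r addr0 => p0.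
have := padic_p_neq0; rewrite -(oF_embed_eq0 F) rmorph_nat p0 eqxx.
by [].
Qed.

Lemma oF_piX_inj n : injective ( *%R (pi ^+ n)).
Proof.
elim: n => [|n IHn] x y; first by rewrite !mul1r.
by rewrite exprSr -!mulrA => /IHn/(oF_mulrI oF_pi_neq0).
Qed.

Lemma oF_embed_unit (y : Zp) : residue_at y 0 != 0 -> ~ congr (oF_embed F y) 0.
Proof.
case/padic_inv_mod=> k [z] /(congr1 (oF_embed F)).
rewrite rmorphM rmorphD rmorphM rmorph1 rmorph_nat => kyz y0.
apply: oF_not_congr1; apply: congr_trans (congr_sym _) _; last first.
  rewrite -(mulr0 (oF_embed F k)); apply: congrM (congr_refl _ _) y0.
rewrite kyz -[X in congr _ X]addr0; apply: congrD (congr_refl _ _) _.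
by rewrite -(mul0r (oF_embed F z)); apply: congrM oF_p_congr0 (congr_refl _ _).
Qed.

(* If all powers of pi divided p, then reducing the monic equation of pi modulo
   successive powers of pi would show that p divides all its coefficients. *)
Lemma oF_p_bounded : exists n, ~ exists y, p%:R = pi ^+ n * y.
Proof.
apply/existsNP => all_n.
have [r [r_monic rpi]] := oF_integral_eq pi.
have rp k : exists z, r`_k = p%:R * z.
  have [m] := ubnP k; elim: m k => // m IHm k lt_km.
  have [le_k|lt_k] := leqP (size r) k.
    by exists 0; rewrite mulr0 nth_default.
  have [t] := sum_pow_split (fun i => oF_embed F r`_i) pi lt_k; rewrite rpi.
  have [s ->] : exists s, \sum_(i < k) oF_embed F r`_i * pi ^+ i = pi ^+ k *
    (pi * s).
    have [y pE] := all_n k.+1.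
    have /choice[z zP] : forall i : 'I_k, exists z, r`_i = p%:R * z.
      by move=> i; apply: IHm; apply: leq_trans (ltn_ord i) _.
    exists (\sum_(i < k) y * oF_embed F (z i) * pi ^+ i).
    rewrite mulrA -exprSr mulr_sumr; apply: eq_bigr => i _.
    by rewrite zP rmorphM rmorph_nat pE; ring.
  rewrite -mulrDr -{1}(mulr0 (pi ^+ k)) => /oF_piX_inj e0.
  have [/eqP rk0|/oF_embed_unit[]] := boolP (residue_at r`_k 0 == 0).
    by have [z ->] := residue_at0_dvd rk0; exists z; rewrite expr1.
  exists (- (s + t)); rewrite add0r mulrN mulrDr; apply/eqP.
  by rewrite -addr_eq0 e0 addrCA addrA eqxx.
have [z] := rp (size r).-1;
  rewrite -[r`__]/(lead_coef r) (monicP r_monic) => e1.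
apply: oF_not_congr1; have [w pw] := oF_p_congr0.
exists (w * oF_embed F z).
by rewrite -(rmorph1 (oF_embed F)) e1 rmorphM rmorph_nat pw; ring.
Qed.

(** e is the largest exponent for which pi^e divides p: the cofactor is outside (pi), hence a unit,
    and e > 0 since p is not one. *)
Lemma oF_ramification : exists e u u',
  [/\ (0 < e)%N, u * u' = 1 & p%:R = pi ^+ e * u].
Proof.
have ex : exists n, `[< ~ exists y, p%:R = pi ^+ n * y >].
  by have [n np] := oF_p_bounded; exists n; apply/asboolP.
case: (ex_minnP ex) => -[|e] /asboolP pe e_min.
  by case: pe; exists p%:R; rewrite mul1r.
have [u pu] : exists u, p%:R = pi ^+ e * u.
  apply: contrapT => npe; have /asboolP/e_min := npe.
  by rewrite ltnn.
have [u' uu'] : exists u', u * u' = 1.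
  apply/oF_unit => -[z u0]; apply: pe; exists z.
  by rewrite pu u0 add0r mulrA exprSr.
exists e, u, u'; split=> //; case: e pu {pe e_min ex} => // pu.
have [z pz] := oF_p_congr0; case: oF_not_congr1; exists (z * u').
by rewrite -uu'; move: pu; rewrite mul1r => <-; rewrite pz; ring.
Qed.

Lemma oF_embed_pi_unit (d : Zp) : d != 0 ->
  exists n w w', oF_embed F d = pi ^+ n * w /\ w * w' = 1.
Proof.
case/padic_valuation=> v [d' [-> d'0]].
have [e [u [u' [_ uu' pE]]]] := oF_ramification.
have [t dt] := (oF_unit _).2 (oF_embed_unit d'0).
exists (e * v)%N, (u ^+ v * oF_embed F d'), (u' ^+ v * t).
rewrite rmorphM rmorphXn rmorph_nat pE exprMn exprM mulrA; split=> //.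
by rewrite mulrACA -exprMn uu' expr1n dt mulr1.
Qed.

(** A non-zero x divides a non-zero element of Z_p, which is a unit times some pi^n, so pi^(n+1)
    cannot divide x. *)
Lemma oF_sep (x : oF) : (forall n, exists y, x = pi ^+ n * y) -> x = 0.
Proof.
move=> xn; apply/eqP; apply: contraT => /oF_dvd_Zp[d [y [d0 dxy]]].
have [n [w [w' [dw ww']]]] := oF_embed_pi_unit d0.
have [z xz] := xn n.+1.
case: oF_not_congr1; exists (z * y * w'); rewrite add0r.
apply: (@oF_piX_inj n); rewrite mulr1.
transitivity (pi ^+ n * w * w'); first by rewrite -mulrA ww' mulr1.
by rewrite -dw dxy xz exprSr !mulrA.
Qed.

Lemma oF_reps : exists s : 'I_q -> oF,
  (forall i j, congr (s i) (s j) -> i = j) /\ forall x, exists i, congr x (s i).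
Proof.
have /card_set_bijP[f [fq f_inj f_surj]] := card_q.
have cosetE x y : congr x y -> coset pi x = coset pi y.
  move=> xy; apply/seteqP; split=> z /=; first by move=> zx;
    apply: congr_trans zx xy.
  by move=> zy; apply: congr_trans zy (congr_sym xy).
have /choice[s sP] : forall i : 'I_q, exists x, f (coset pi x) = i.
  by move=> i; have [A [x _ <-] fA] := f_surj i (ltn_ord i); exists x.
exists s; split=> [i j /cosetE sij|x].
  by apply: val_inj; rewrite /= -!sP sij.
have lt_x : (f (coset pi x) < q)%N by apply: fq; exists x.
have [i fi] : exists i : 'I_q, f (coset pi x) = i by exists (Ordinal lt_x).
exists i; apply: congr_sym.
suff E : coset pi x = coset pi (s i).
  by rewrite -[congr _ _]/(coset pi x (s i)) E; apply: congr_refl.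
by apply: f_inj; rewrite ?inE ?sP.
Qed.

Lemma oF_reps_piX n : exists N (s : 'I_N -> oF), forall x, exists i y, x = s i
  + pi ^+ n * y.
Proof.
have [s [_ s_surj]] := oF_reps.
elim: n => [|n [N [t tP]]].
  by exists 1%N, (fun=> 0) => x; exists ord0, x; rewrite add0r mul1r.
exists #|{: 'I_N * 'I_q}|.
exists (fun k => t (enum_val k).1 + pi ^+ n * s (enum_val k).2) => x.
have [i [y ->]] := tP x; have [j [z ->]] := s_surj y.
exists (enum_rank (i, j)), z.
by rewrite enum_rankK /= exprSr; ring.
Qed.

(** No Z_p-basis of o_F is used. With carries, the terms are rewritten with digits in a finite set
    of representatives modulo p; grouping by digit leaves finitely many series in Z_p with
    coefficients 0 or 1. *)
Lemma oF_series_p (y : nat -> oF) : exists x, forall n, exists t,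
  x = \sum_(k < n) p%:R ^+ k * y k + p%:R ^+ n * t.
Proof.
have [e [u [u' [_ uu' pE]]]] := oF_ramification.
have [N [s sP]] := oF_reps_piX e.
have /choice[J /choice[T JT]] : forall x, exists j, exists t, x = s j + p%:R *
  t.
  move=> x; have [j [z ->]] := sP x; exists j, (u' * z).
  by rewrite pE -[in LHS](mul1r z) -uu'; ring.
have [j [r [r0 yE]]] : exists (j : nat -> 'I_N) (r : nat -> oF),
    r 0 = 0 /\ forall k, y k = s (j k) + p%:R * r k.+1 - r k.
  (* [r] is the sequence of carries; the terms p r_(k+1) - r_k telescope in the partial sums. *)
  pose r := fix r k := if k is k'.+1 then T (r k' + y k') else 0.
  exists (fun k => J (r k + y k)), r; split=> // k.
  by rewrite /= -JT addrC addKr.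
have sumE n : \sum_(k < n) p%:R ^+ k * y k = \sum_(k < n) p%:R ^+ k * s (j k) +
  p%:R ^+ n * r n.
  elim: n => [|n IHn]; first by rewrite !big_ord0 r0 mulr0 addr0.
  by rewrite !big_ord_recr /= IHn yE exprSr; ring.
have /choice[z zP] := fun i => padic_series (fun k => (j k == i)%:R : Zp).
exists (\sum_i oF_embed F (z i) * s i) => n.
have /choice[t tP] := fun i => zP i n.
exists (\sum_i oF_embed F (t i) * s i - r n).
rewrite sumE mulrBr addrACA subrr addr0 mulr_sumr.
have -> : \sum_(k < n) p%:R ^+ k * s (j k) =
    \sum_i \sum_(k < n) p%:R ^+ k * ((j k == i)%:R * s i).
  rewrite exchange_big; apply: eq_bigr => k _; rewrite -mulr_sumr;
    congr (_ * _).
  rewrite (bigD1 (j k)) // big1 => [|i]; first by rewrite eqxx [RHS]addr0 mul1r.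
  by rewrite eq_sym => /negbTE ->; rewrite mul0r.
rewrite -big_split; apply: eq_bigr => i _;
  rewrite tP rmorphD rmorph_sum mulrDl mulr_suml.
rewrite rmorphM rmorphXn rmorph_nat mulrA; congr (_ + _).
by apply: eq_bigr => k _; rewrite rmorphM rmorphXn !rmorph_nat mulrA.
Qed.

Lemma oF_complete (y : nat -> oF) : exists x, forall n, exists t,
  x = \sum_(k < n) pi ^+ k * y k + pi ^+ n * t.
Proof.
have [e [u [u' [e_gt0 uu' pE]]]] := oF_ramification.
pose S (z : nat -> oF) n := \sum_(k < n) pi ^+ k * z k.
have S_add z m n : S z (m + n)%N = S z m + pi ^+ m * S (fun k => z (m + k)%N) n.
  rewrite /S big_split_ord /= mulr_sumr; congr (_ + _).
  by apply: eq_bigr => k _; rewrite exprD mulrA.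
(* Blocks of e consecutive terms become one term of a p-adic series, as pi^(e m) = p^m u'^m. *)
pose Y m := u' ^+ m * S (fun k => y (e * m + k)%N) e.
have [x xP] := oF_series_p Y; exists x => n.
have [t ->] := xP n.
have -> : \sum_(m < n) p%:R ^+ m * Y m = S y (e * n)%N.
  elim: n {t} => [|n IHn]; first by rewrite muln0 /S !big_ord0.
  rewrite big_ord_recr /= IHn mulnS addnC S_add; congr (_ + _).
  by rewrite /Y mulrA -exprMn pE -mulrA uu' mulr1 exprM.
have le_n : (n <= e * n)%N by rewrite leq_pmull.
exists (S (fun k => y (n + k)%N) (e * n - n)%N + pi ^+ (e * n - n)%N * (u ^+ n
  * t)).
rewrite -{1}(subnKC le_n) S_add mulrDr addrA; congr (_ + _).
by rewrite mulrA -exprD subnKC // pE exprMn -exprM mulrA.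
Qed.

Lemma oF_complete_dvr : complete_dvr pi q.
Proof.
split.
- exact: oF_mulrI oF_pi_neq0.
- exact: oF_sep.
- exact: oF_complete.
- exact: oF_unit.
- exact: oF_reps.
Qed.

End RingOfIntegersDvr.

(** * Integer-valued polynomials *)

Section PolynomialCoefficients.
Context (p : nat) (p_prime : prime p) (F : fieldExtType 'Q_[p_prime]).
Context (pi : 'o_[F]) (q : nat) (LT : lubin_tate pi q).
Hypotheses (unif : uniformizer pi) (card_q : residue_card pi q).
Local Notation oF := ('o_[F]).
Local Notation act := (lt_act LT).

Definition polynomial_fun (u : oF -> oF) : Prop :=
  exists c : {poly F}, forall a : oF, c.[a : F] = integer_val (u a).

Lemma polynomial_fun_const b : polynomial_fun (fun=> b).
Proof. by exists (integer_val b)%:P => a; rewrite hornerC. Qed.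

Lemma polynomial_funD u v :
  polynomial_fun u -> polynomial_fun v -> polynomial_fun (fun a => u a + v a).
Proof. by move=> [c cu] [d dv]; exists (c + d) => a; rewrite hornerD cu dv. Qed.

Lemma polynomial_funM u v :
  polynomial_fun u -> polynomial_fun v -> polynomial_fun (fun a => u a * v a).
Proof. by move=> [c cu] [d dv]; exists (c * d) => a; rewrite hornerM cu dv. Qed.

Lemma polynomial_fun_sum (I : finType) (P : pred I) (u : I -> oF -> oF) :
  (forall i, P i -> polynomial_fun (u i)) ->
  polynomial_fun (fun a => \sum_(i | P i) u i a).
Proof.
move=> uP; have -> : (fun a => \sum_(i | P i) u i a) = \sum_(i | P i) u i.
  by apply/funext => a; rewrite fct_sumE.
by apply: big_ind => //; [exact: polynomial_fun_const|exact: polynomial_funD].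
Qed.

Lemma polynomial_fun_exp (u : oF -> {fps oF}) n k i :
  (forall j, (j < n)%N -> polynomial_fun (fun a => u a j)) -> (i < n)%N ->
  polynomial_fun (fun a => (u a ^+ k) i).
Proof.
move=> uP; elim: k i => [|k IHk] i lt_in; first exact: polynomial_fun_const.
have -> : (fun a => (u a ^+ k.+1) i) =
    (fun a => \sum_(j < i.+1) u a j * (u a ^+ k) (i - j)%N).
  by apply/funext => a; rewrite exprS.
apply: polynomial_fun_sum => j _; apply: polynomial_funM.
  by apply: uP; apply: leq_trans lt_in; rewrite ltnS -ltnS.
by apply: IHk; apply: leq_ltn_trans lt_in; apply: leq_subr.
Qed.

(** As u has no constant term, its coefficient of degree n enters that of u^k only for k = 1. *)
Lemma polynomial_fun_exp_top (u : oF -> {fps oF}) n k :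
  (forall a, u a 0 = 0) ->
  (forall j, (j < n)%N -> polynomial_fun (fun a => u a j)) -> k != 1%N ->
  polynomial_fun (fun a => (u a ^+ k) n).
Proof.
move=> u0 uP; case: k => [|[//|k]] _; first exact: polynomial_fun_const.
have -> : (fun a => (u a ^+ k.+2) n) =
    (fun a => \sum_(j < n.+1) u a j * (u a ^+ k.+1) (n - j)%N).
  by apply/funext => a; rewrite exprS.
apply: polynomial_fun_sum => j _.
have [j0|j_gt0] := posnP j.
  have -> : (fun a => u a j * (u a ^+ k.+1) (n - j)%N) = (fun=> 0).
    by apply/funext => a; rewrite j0 u0 mul0r.
  exact: polynomial_fun_const.
have [le_nj|lt_jn] := leqP n j.
  have -> : (fun a => u a j * (u a ^+ k.+1) (n - j)%N) = (fun=> 0).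
    apply/funext => a; move: le_nj; rewrite -subn_eq0 => /eqP ->.
    by rewrite fps_exp_order // mulr0.
  exact: polynomial_fun_const.
apply: polynomial_funM; first exact: uP.
by apply: polynomial_fun_exp uP _; rewrite ltn_subrL j_gt0 (leq_trans _ lt_jn).
Qed.

Lemma fps_exp_lead (R : comNzRingType) (g : {fps R}) n : g 0 = 0 -> (g ^+ n) n
  = g 1 ^+ n.
Proof.
move=> g0; have -> : g = fpsX R * Fps (fun k => g k.+1).
  by apply/fpsP => -[|k]; rewrite coef_fpsXM.
rewrite exprMn coef_fpsXnM ltnn subnn coef_fpsXM /=; elim: n => // n IHn.
by rewrite !exprS /= big_ord1 IHn.
Qed.

(* Comparing coefficients in [pi]([a](X)) = [a]([pi](X)) expresses
   (pi - pi^n) a_n as a polynomial in the lower coefficients of [a](X). *)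
Lemma lt_act_polynomial n : polynomial_fun (fun a => act a n).
Proof.
have [m] := ubnP n; elim: m n => // m IHm n lt_nm.
have uP j : (j < n)%N -> polynomial_fun (fun a => act a j).
  by move=> lt_jn; apply: IHm; apply: leq_trans lt_jn _.
case: n lt_nm uP => [|[|n]] lt_nm uP.
- by exists 0 => a; rewrite horner0 lt_act0.
- by exists 'X => a; rewrite hornerX lt_act1.
set N := n.+2 in uP *.
pose u a := \sum_(k < N) act a k * (act pi ^+ k) N
  + (- 1) * \sum_(k < N.+1 | k != 1%N :> nat) act pi k * (act a ^+ k) N.
have [c cu] : polynomial_fun u.
  apply: polynomial_funD.
    apply: polynomial_fun_sum => k _;
      apply: polynomial_funM (polynomial_fun_const _).
    exact: uP.
  apply: polynomial_funM (polynomial_fun_const _) _.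
  apply: polynomial_fun_sum => k k1;
    apply: polynomial_funM (polynomial_fun_const _) _.
  by apply: polynomial_fun_exp_top => // a; apply: lt_act0.
have uE a : (pi - pi ^+ N) * act a N = u a.
  have lhsE : fps_comp (act pi) (act a) N = pi * act a N
      + \sum_(k < N.+1 | k != 1%N :> nat) act pi k * (act a ^+ k) N.
    transitivity (\sum_(k < N.+1) act pi k * (act a ^+ k) N);
      first exact: erefl.
    pose i1 := Ordinal (isT : (1 < N.+1)%N).
    by rewrite (bigD1 i1 isT) -[nat_of_ord i1]/1%N lt_act1 expr1.
  have rhsE : fps_comp (act a) (act pi) N =
      \sum_(k < N) act a k * (act pi ^+ k) N + act a N * pi ^+ N.
    transitivity (\sum_(k < N.+1) act a k * (act pi ^+ k) N);
      first exact: erefl.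
    rewrite big_ord_recr; congr (_ + _ * _).
    by rewrite fps_exp_lead ?lt_act0 // lt_act1.
  have e : fps_comp (act pi) (act a) N = fps_comp (act a) (act pi) N.
    by rewrite !lt_act_comp mulrC.
  rewrite /u; move: (etrans (esym lhsE) (etrans e rhsE)).
  set A := \sum_(k < N) _; set B := \sum_(_ < _ | _) _ => AB.
  have -> : A = pi * act a N + B - act a N * pi ^+ N by rewrite AB addrK.
  by move: (act a N) A B {AB lhsE rhsE e} => x A B; ring.
have d0 : integer_val (pi - pi ^+ N) != 0.
  apply/eqP => d0; apply: (oF_not_congr1 unif); exists (pi ^+ n);
    rewrite add0r -exprS.
  apply: (oF_mulrI (oF_pi_neq0 unif)); rewrite mulr1 -exprS.
  by apply/eqP; rewrite -subr_eq0; apply/eqP/val_inj.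
(* The divisor is a multiple of pi, which forces coefficients in F although the values stay in
   o_F. *)
exists ((integer_val (pi - pi ^+ N))^-1 *: c) => a.
rewrite hornerZ cu -uE; apply: (mulfI d0); rewrite mulrA mulfV // mul1r.
by [].
Qed.

Lemma lt_coef_polynomial f n : exists c, Int F c /\ is_lt_coef LT f n c.
Proof.
suff [c cP] : polynomial_fun (lt_coef LT f n).
  by exists c; split=> // a; rewrite cP; apply: valP.
apply: polynomial_fun_sum => k _;
  apply: polynomial_funM (polynomial_fun_const _) _.
by apply: (polynomial_fun_exp (n := n.+1)) => // j _; apply: lt_act_polynomial.
Qed.

End PolynomialCoefficients.

(** * Denominators of elements of F *)

Section Denominators.
Context (p : nat) (p_prime : prime p) (F : fieldExtType 'Q_[p_prime]).
Local Notation Zp := 'Z_[p_prime].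

Lemma fraction_denominator (R : idomainType) (x : {fraction R}) :
  exists d a, d != 0 /\ FracField.tofrac d * x = FracField.tofrac a.
Proof.
elim/quotW: x => r; exists \d_r, \n_r; split; first exact: denom_ratioP.
unlock FracField.tofrac; rewrite -[LHS]FracField.pi_mul; apply/eqmodP => /=.
rewrite FracField.equivfE /FracField.mulf !numden_Ratio ?mul1r ?mulr1
  ?oner_neq0 ?denom_ratioP //.
Qed.

(** D clears the denominators of the minimal polynomial of x, of degree n; then D x is a root of the
    monic polynomial with coefficients D^(n-i) m_i. *)
Lemma integer_denominator (x : F) :
  exists d : Zp, d != 0 /\ Zp_embed F d * x \in @integer p p_prime F.
Proof.
have /polyOver1P[r rE] := minPolyOver 1%AS x.
have /choice[d /choice[a da]] := fun i => fraction_denominator r`_i.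
set n := adjoin_degree 1%AS x; pose D := \prod_(i < n) d i.
have D0 : D != 0 by apply/prodf_neq0 => i _; case: (da i).
exists D; split=> //.
pose m := minPoly 1%AS x.
have mn : m`_n = 1.
  by have /monicP := monic_minPoly 1%AS x; rewrite /lead_coef size_minPoly.
have DE (i : 'I_n) : exists z, Zp_embed F D * m`_i = Zp_embed F z.
  exists ((\prod_(j < n | j != i) d j) * a i).
  have [_ dE] := da i.
  rewrite /D (bigD1 i) //= rmorphM /m rE coef_map /=.
  rewrite -mulrA mulrCA [RHS]rmorphM; congr (_ * _).
  by rewrite -[RHS]/((FracField.tofrac (a i))%:A) -dE -scalerAl mul1r scalerA.
apply/asboolP.
pose P := \poly_(i < n.+1) (Zp_embed F D ^+ (n - i) * m`_i).
apply: (integral_root_monic (p := P)).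
- rewrite monicE lead_coef_poly //= subnn mn mul1r //.
  exact: oner_neq0.
- rewrite /root horner_poly.
  have := minPolyxx 1%AS x; rewrite -/m (horner_coef m) size_minPoly -/n => mx.
  apply/eqP; rewrite -[RHS](mulr0 (Zp_embed F D ^+ n)) -[in RHS]mx mulr_sumr.
  apply: eq_bigr => i _; rewrite exprMn.
  have le_in : (i <= n)%N by rewrite -ltnS.
  by rewrite mulrACA -exprD subnK // -mulrA.
- move=> _ /(nthP 0)[i _ <-]; rewrite coef_poly; case: ltnP => [|_];
  last exact: integral0.
  rewrite ltnS leq_eqVlt => /predU1P[->|lt_in].
    by rewrite subnn mn mul1r; apply: integral1.
  have [z zE] := DE (Ordinal lt_in).
  rewrite -(prednK (_ : (0 < n - i)%N)) ?subn_gt0 // exprSr -mulrA [_ * m`_i]zE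
    -rmorphXn -rmorphM.
  exact: integral_id.
Qed.

End Denominators.

Section Congruence.
Context (p : nat) (p_prime : prime p) (F : fieldExtType 'Q_[p_prime]).
Context (pi : 'o_[F]) (q : nat).
Hypothesis unif : uniformizer pi.

Lemma pi_denominator (x : F) : exists n, forall m, (n <= m)%N ->
  exists y : 'o_[F], integer_val (pi ^+ m) * x = integer_val y.
Proof.
have [d [d0 dx]] := integer_denominator x.
have [n [w [w' [dw ww']]]] := oF_embed_pi_unit unif d0.
exists n => m le_nm; exists (pi ^+ (m - n) * w' * RingOfIntegers dx).
have -> : pi ^+ m = pi ^+ (m - n) * w' * oF_embed F d.
  by rewrite dw mulrACA [w' * w]mulrC ww' mulr1 -exprD subnK.
by rewrite !integer_valM -mulrA.
Qed.

(** If pi^M clears the coefficients of P, a shift by a multiple of pi^(M+1) changes each monomial of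
    P by a multiple of pi. *)
Lemma Int_locally_const (P : {poly F}) (w : 'o_[F] -> 'o_[F]) :
  (forall a : 'o_[F], P.[a : F] = integer_val (w a)) ->
  exists L, forall a c, congr_mod pi (w (a + pi ^+ L * c)) (w a).
Proof.
move=> Pw; have /choice[N NP] := fun i => pi_denominator P`_i.
pose M := (\max_(i < size P) N i)%N; exists M.+1 => a c.
have /choice[y yP] : forall i : 'I_(size P), exists y : 'o_[F],
    integer_val (pi ^+ M) * P`_i = integer_val y.
  by move=> i; apply: NP; apply: (leq_bigmax i).
have /choice[z zP] : forall i : 'I_(size P), exists z : 'o_[F],
    (a + pi ^+ M.+1 * c) ^+ i = a ^+ i + pi ^+ M.+1 * z.
  by move=> i; apply: (congrX i (m := pi ^+ M.+1)); exists c.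
exists (\sum_i y i * z i); apply: val_inj.
have sumE : integer_val (\sum_i y i * z i) = \sum_i integer_val (y i * z i).
  exact: (rmorph_sum val).
rewrite [RHS]integer_valD integer_valM sumE.
rewrite -[LHS]Pw -Pw !horner_coef mulr_sumr -big_split.
apply: eq_bigr => i _; rewrite -[RHS]/(_ + _).
have -> : (integer_val (a + pi ^+ M.+1 * c)) ^+ i =
    integer_val a ^+ i + integer_val pi * (integer_val (pi ^+ M) * integer_val
      (z i)).
  by rewrite -integer_valX zP integer_valD exprS !integer_valM integer_valX
    mulrA.
by rewrite integer_valM -yP; ring.
Qed.

End Congruence.

(** * Spans over o_F, and the return from functions to polynomials *)

Lemma oF_span0 (p : nat) (p_prime : prime p) (F : fieldExtType 'Q_[p_prime])
    (C : set {poly F}) : oF_span C 0.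
Proof. by exists 0%N, (fun=> 0), (fun=> 0); split; [case|rewrite big_ord0]. Qed.

Lemma oF_spanD (p : nat) (p_prime : prime p) (F : fieldExtType 'Q_[p_prime])
    (C : set {poly F}) P Q : oF_span C P -> oF_span C Q -> oF_span C (P + Q).
Proof.
move=> [m [k [c [cC ->]]]] [n [l [d [dC ->]]]].
exists (m + n)%N, (fun i => match fintype.split i with inl j => k j | inr j =>
  l j end),
  (fun i => match fintype.split i with inl j => c j | inr j => d j end).
split=> [i|]; first by case: (fintype.split i).
rewrite big_split_ord; congr (_ + _); apply: eq_bigr => i _.
  by rewrite (unsplitK (inl i)).
by rewrite (unsplitK (inr i)).
Qed.

Lemma oF_spanZ (p : nat) (p_prime : prime p) (F : fieldExtType 'Q_[p_prime])
    (C : set {poly F}) (a : 'o_[F]) P : oF_span C P -> oF_span C (integer_val a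
      *: P).
Proof.
move=> [m [k [c [cC ->]]]]; exists m, (fun i => a * k i), c; split=> //.
by rewrite scaler_sumr; apply: eq_bigr => i _; rewrite integer_valM scalerA.
Qed.

Lemma oF_span_mem (p : nat) (p_prime : prime p) (F : fieldExtType 'Q_[p_prime])
    (C : set {poly F}) P : C P -> oF_span C P.
Proof.
by exists 1%N, (fun=> 1), (fun=> P); split=> //; rewrite big_ord1 scale1r.
Qed.

Theorem theoremB (p : nat) (p_prime : prime p) (F : fieldExtType 'Q_[p_prime])
    (pi : 'o_[F]) (q : nat) (LT : lubin_tate pi q) :
  uniformizer pi -> residue_card pi q ->
  [set P + (pi : F) *: Q | P in Pol LT (psi_kernel LT) & Q in Int F] = Int F.
Proof.
move=> unif card_q; apply/seteqP; split=> [_ [P PK [Q QI <-]] a|P PI].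
  rewrite hornerD hornerZ; apply: rpredD; last by apply: rpredM;
    [exact: valP|exact: QI].
  have [n [l [c [cI ->]]]] := PK; rewrite horner_sum; apply: rpred_sum => i _.
  rewrite hornerZ; apply: rpredM; first exact: valP.
  by have [f [k [_ cInt _]]] := cI i; apply: cInt.
pose K := psi_kernel LT.
(* The functions that agree modulo pi, at every point of o_F, with an element of Pol(K). *)
pose W : set ('o_[F] -> 'o_[F]) := fun u => exists P', Pol LT K P' /\
  forall a : 'o_[F], exists z : 'o_[F], P'.[a : F] = integer_val (u a + pi * z).
pose w a := RingOfIntegers (PI a).
have [L wL] : exists L, forall a c, congr_mod pi (w (a + pi ^+ L * c)) (w a).
  exact: (Int_locally_const unif (P := P)).
have [P' [P'K P'w]] : W w.
  apply: (psi_kernel_locally_const (LT := LT) (oF_complete_dvr unif card_q) _ _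
    wL).
    split.
    - exists 0; split; first exact: oF_span0.
      by move=> a; exists 0; rewrite horner0 mulr0 addr0.
    - move=> u v [P1 [P1K P1u]] [P2 [P2K P2v]]; exists (P1 + P2).
      split=> [|a]; first exact: oF_spanD.
      have [[z zE] [t tE]] := (P1u a, P2v a); exists (z + t).
      by rewrite hornerD zE tE mulrDr addrACA -integer_valD.
    - move=> c u [P1 [P1K P1u]]; exists (integer_val c *: P1).
      split=> [|a]; first exact: oF_spanZ.
      have [z zE] := P1u a; exists (c * z).
      by rewrite hornerZ zE -integer_valM mulrDr mulrCA.
    - move=> u v [P1 [P1K P1u]] uv; exists P1; split=> // a.
      have [[z ->] [t ->]] := (P1u a, uv a); exists (t + z).
      by rewrite mulrDr addrA.
  move=> f n fK; have [c [cI fc]] := lt_coef_polynomial LT unif f n.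
  exists c; split; first by apply: oF_span_mem; exists f, n.
  by move=> a; exists 0; rewrite mulr0 addr0 fc.
have pi0 : integer_val pi != 0.
  apply: contra (oF_pi_neq0 unif) => /eqP pi0; apply/eqP/val_inj.
  exact: pi0.
(* Agreement of P and P' modulo pi at all points says exactly that this quotient is
   integer-valued. *)
exists P' => //; exists ((pi : F)^-1 *: (P - P')).
  move=> a; have [z zE] := P'w a.
  rewrite hornerZ hornerD hornerN zE integer_valD integer_valM.
  by rewrite opprD addNKr mulrN mulKf // rpredN; apply: valP.
by rewrite scalerA divff // scale1r addrC subrK.
Qed.
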